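(* Let $Q=\langle s,w_2\rangle\le\mathrm{M}(11,\mathbb{C})$ (so $Q\cong M_{11}$). Let $\mathcal{Q}^*$ be the set consisting of (a) all groups $\langle s,w_2,A\rangle$ with $A$ a finite subgroup of $\mathrm{D}(11,\mathbb{C})$ invariant under conjugation by $\mathrm{Sym}(11)$ and not contained in the scalar matrices, and (b) all groups $\langle s,w_2d_{n+1},A\rangle$ with $n\ge0$ and $A$ a finite subgroup of $\mathrm{D}(11,\mathbb{C})$ invariant under conjugation by $\mathrm{Sym}(11)$ such that $A\cap X_{\{2\}}=\Omega_nX_{\{2\}}$. Then $\mathcal{Q}^*$ is a classification of the finite irreducible subgroups of $\mathrm{M}(11,\mathbb{C})$ with permutation part $M_{11}$: each group in $\mathcal{Q}^*$ is such a group, each such group is $\mathrm{GL}(11,\mathbb{C})$-conjugate to a group in $\mathcal{Q}^*$, and distinct groups in $\mathcal{Q}^*$ are not $\mathrm{GL}(11,\mathbb{C})$-conjugate.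
   Context: $\mathrm{M}(11,\mathbb{C})$ is the group of monomial matrices, $\mathrm{D}(11,\mathbb{C})$ the invertible diagonal matrices; permutations $\alpha$ are identified with permutation matrices $[\delta_{i\alpha,j}]_{i,j}$. The permutation part of a monomial group is its image under $dt\mapsto t$. $s$ is the permutation matrix of $(1,2,\ldots,11)$ and $w_2$ that of $(1,3)(2,8)(4,7)(5,6)$. For $n\ge1$, $d_n=\mathrm{diag}(\epsilon_n,\epsilon_n^{-1},\epsilon_n^{-1},1,\epsilon_n^{-1},\epsilon_n,1,\epsilon_n,1,1,1)$ with $\epsilon_n=e^{\pi i/2^{n-1}}$. $X=\mathrm{SL}(11,\mathbb{C})\cap\mathrm{D}(11,\mathbb{C})$, $X_{\{2\}}$ is its subgroup of elements of $2$-power order, and $\Omega_nX_{\{2\}}=\{a\in X_{\{2\}}:a^{2^n}=1\}$. *)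

(* Defs.v *)
From HB Require Import structures.
From mathcomp Require Import all_boot all_order all_algebra all_fingroup.
From mathcomp Require Import boolp classical_sets cardinality reals complex.

Set Implicit Arguments.
Unset Strict Implicit.
Unset Printing Implicit Defensive.

Import Order.TTheory GRing.Theory Num.Theory.
Local Open Scope classical_set_scope.
Local Open Scope ring_scope.

Section Defs.
Variable R : realType.
Notation C := (R[i]).
Notation Mx := ('M[C]_11).

Definition is_grp (G : set Mx) : Prop :=
  [/\ G 1%:M,
      (forall x, G x -> x \in unitmx),
      (forall x y, G x -> G y -> G (x *m y)) &
      (forall x, G x -> G (invmx x))].

Definition gen (S : set Mx) : set Mx :=
  fun x => forall G, is_grp G -> S `<=` G -> G x.

Definition conj_set (g : Mx) (H : set Mx) : set Mx :=
  [set invmx g *m h *m g | h in H].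

Definition GLconj (H K : set Mx) : Prop :=
  exists2 g : Mx, g \in unitmx & K = conj_set g H.

(* M(11,C): matrices d t with d invertible diagonal and t a permutation
   matrix; perm_mx a = [delta_{i a, j}]_{i,j}. *)
Definition monomial (M : Mx) : Prop :=
  exists (a : 'S_11) (d : 'rV[C]_11),
    (forall i, d 0 i != 0) /\ M = diag_mx d *m perm_mx a.

Definition perm_part (G : set Mx) : {set 'S_11} :=
  [set a : 'S_11 | `[< exists d : 'rV[C]_11,
       (forall i, d 0 i != 0) /\ G (diag_mx d *m perm_mx a) >]].

Definition irreducible_grp (G : set Mx) : Prop :=
  forall U : Mx, (forall g, G g -> (U *m g <= U)%MS) ->
    U = 0 \/ row_full U.

Definition o (k : nat) : 'I_11 := inord k.

(* s = (1,2,...,11), i.e. (0,1,...,10) in 0-based indexing *)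
Definition s_perm : 'S_11 := perm (@ordS_inj 11).
(* w_2 = (1,3)(2,8)(4,7)(5,6), i.e. (0,2)(1,7)(3,6)(4,5) 0-based *)
Definition w2_perm : 'S_11 :=
  (tperm (o 0) (o 2) * tperm (o 1) (o 7) * tperm (o 3) (o 6)
   * tperm (o 4) (o 5))%g.

Definition M11 : {set 'S_11} := <<[set s_perm; w2_perm]%SET>>%g.

Definition s_mx : Mx := perm_mx s_perm.
Definition w2_mx : Mx := perm_mx w2_perm.

(* eps_n = e^{pi i / 2^(n-1)}: the 2^(n-1)-th root of -1 of least
   nonnegative argument *)
Definition eps (n : nat) : C := (2 ^ n.-1)%N.-root (-1).

Definition d_mx (n : nat) : Mx :=
  let e := eps n in
  diag_mx (\row_(i < 11)
    nth 1 [:: e; e^-1; e^-1; 1; e^-1; e; 1; e; 1; 1; 1] i).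

Definition diag_grp (A : set Mx) : Prop :=
  is_grp A /\ (forall a, A a -> is_diag_mx a).

Definition Sym_invariant (A : set Mx) : Prop :=
  forall (t : 'S_11) a, A a -> A (invmx (perm_mx t) *m a *m perm_mx t).

Definition X (a : Mx) : Prop := [/\ a \in unitmx, is_diag_mx a & \det a = 1].
Definition X2 (a : Mx) : Prop := X a /\ exists k : nat, a ^+ (2 ^ k) = 1%:M.
Definition OmegaX2 (n : nat) (a : Mx) : Prop := X2 a /\ a ^+ (2 ^ n) = 1%:M.

Definition Qstar_a (H : set Mx) : Prop :=
  exists A : set Mx,
    [/\ diag_grp A, finite_set A, Sym_invariant A,
        ~ (forall a, A a -> is_scalar_mx a) &
        H = gen ([set s_mx; w2_mx] `|` A)].

Definition Qstar_b (H : set Mx) : Prop :=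
  exists (n : nat) (A : set Mx),
    [/\ diag_grp A, finite_set A, Sym_invariant A,
        A `&` X2 = OmegaX2 n &
        H = gen ([set s_mx; w2_mx *m d_mx n.+1] `|` A)].

Definition Qstar : set (set Mx) := fun H => Qstar_a H \/ Qstar_b H.

Definition good_grp (G : set Mx) : Prop :=
  [/\ is_grp G, finite_set G, G `<=` monomial, irreducible_grp G &
      isog (perm_part G) M11].

End Defs.

(* Main.v *)
Require Import Defs.
From HB Require Import structures.
From mathcomp Require Import all_boot all_order all_algebra all_fingroup.
From mathcomp Require Import boolp classical_sets cardinality reals complex.
From mathcomp Require Import cyclic ring.

Set Implicit Arguments.
Unset Strict Implicit.
Unset Printing Implicit Defensive.

Import Order.TTheory GRing.Theory Num.Theory.

(* Let G be a finite irreducible monomial group with permutation part M11 and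
   diagonal part A. The matrix of the transposition (0 1) is an integral
   combination of the matrices of M11, so A is invariant under Sym(11). Hence,
   for some m, A lies between the diagonal matrices of determinant 1 with
   entries in mu_m and the scalar multiples of those with entries in mu_m.
   After a diagonal conjugation G contains a scalar multiple of s, and one
   relator of length 20 determines the entries of any lift of w2, up to scalars
   and mu_m, up to an 11-th root of unity (removed by a further diagonal
   conjugation) and one sign, which is the difference between the two families.
   As s and w2 are commutators, the exact generators then lie in G.
   Conversely <s, w2 diag(-1, -1, -1, 1, -1, -1, 1, -1, 1, 1, 1)> acts on a
   ternary Golay code, which shows that it meets the diagonal group trivially,
   and so that the groups of both families have diagonal part A. As M11 has no
   nontrivial
   abelian normal subgroup, conjugation preserves diagonal parts; it is then
   monomial unless A is scalar, and the quotients x_ii^11 / det x tell the two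
   families apart. *)

(** * Words in the generators of M11 *)

(** Everything is compared after raising entries to the power [m] of the sandwich. Elements of A
    become scalar and its lower bound becomes trivial, so a relation of M11, which lifts to G only
    up to an element of A, turns into equations in the field. Conversely, a diagonal correction of
    determinant 1 whose entries have m-th power 1 lies in A, so a matrix with given permutation is
    known modulo A from its determinant and the m-th powers of its entries. The remaining sign is
    [e = z ^+ m], where [z] is the parameter of the lift of [w2]. The value 1 is realised by
    [z = 1], and -1 by [z = eps (n + 1)] with [2 ^ n] the exact power of 2 dividing [m]; this is the
    origin of the index n and of the condition on the intersection of A with the 2-part of X. When
    [e = -1], the m-th powers of the entries of a word are the signs of the same word in [s] and
    [w2_mx *m d_mx 1], so a single computation with signs serves every n. *)

(* A word is a sequence of letters, [false] for [s] and [true] for [w2],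
   multiplied from left to right; the points are 0, ..., 10. *)
Definition s_nat (i : nat) : nat := if i == 10 then 0 else i.+1.
Definition w2_nat (i : nat) : nat :=
  nth 0 [:: 2; 7; 0; 6; 5; 4; 3; 1; 8; 9; 10] i.
Definition letter_nat (b : bool) (i : nat) := if b then w2_nat i else s_nat i.
Definition word_nat (v : seq bool) (i : nat) : nat :=
  foldl (fun j b => letter_nat b j) i v.

(* [sylls [:: a0; a1; ...; ak]] is the word s^a0 w2 s^a1 w2 ... w2 s^ak. *)
Fixpoint sylls (l : seq nat) : seq bool :=
  match l with
  | [::] => [::]
  | [:: a] => nseq a false
  | a :: l' => nseq a false ++ true :: sylls l'
  end.

Definition pword (p q : 'S_11) (v : seq bool) : 'S_11 :=
  foldr (fun b r => ((if b then q else p) * r)%g) 1%g v.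

Definition wperm : seq bool -> 'S_11 := pword s_perm w2_perm.

Lemma val_o k : k < 11 -> val (o k) = k.
Proof. by move=> ltk; rewrite /o /= inordK. Qed.

Lemma o_val (i : 'I_11) : o (val i) = i.
Proof. by apply: val_inj; rewrite val_o //; exact: ltn_ord. Qed.

Lemma forall_ord11 (P : nat -> Prop) :
  (forall k, k \in iota 0 11 -> P k) -> forall i : 'I_11, P i.
Proof. by move=> HP i; apply: HP; rewrite mem_iota /=. Qed.

Lemma s_permE (i : 'I_11) : s_perm i = s_nat i :> nat.
Proof.
by rewrite /s_perm permE; case: i => -[|[|[|[|[|[|[|[|[|[|[|k]]]]]]]]]]].
Qed.

Lemma tperm_val (a b : nat) (i : 'I_11) : a < 11 -> b < 11 ->
  tperm (o a) (o b) i =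
  (if i == a :> nat then b else if i == b :> nat then a else i) :> nat.
Proof.
move=> lta ltb; case: tpermP => [->|->|].
- by rewrite !val_o // eqxx.
- by rewrite !val_o // eqxx; case: eqP.
- move=> /eqP na /eqP nb; rewrite -(inj_eq val_inj) val_o //= in na.
  by rewrite -(inj_eq val_inj) val_o //= in nb; rewrite (negPf na) (negPf nb).
Qed.

Lemma w2_permE (i : 'I_11) : w2_perm i = w2_nat i :> nat.
Proof.
rewrite /w2_perm !permM !tperm_val //.
by case: i => -[|[|[|[|[|[|[|[|[|[|[|k]]]]]]]]]]].
Qed.

Lemma pwordM p q u v : pword p q (u ++ v) = (pword p q u * pword p q v)%g.
Proof. by elim: u => [|b u IH] /=; rewrite ?mul1g // IH mulgA. Qed.

Lemma pword_nseq p q n : pword p q (nseq n false) = (p ^+ n)%g.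
Proof. by elim: n => [|n IH] //=; rewrite IH expgS. Qed.

Lemma pwordJ p q x v : pword (p ^ x) (q ^ x) v = (pword p q v ^ x)%g.
Proof.
by elim: v => [|b v IH] /=; rewrite ?conj1g // IH conjMg; case: b.
Qed.

Lemma letter_permE b (i : 'I_11) :
  (if b then w2_perm else s_perm) i = letter_nat b i :> nat.
Proof. by case: b; rewrite /= ?w2_permE ?s_permE. Qed.

Lemma wpermE v (i : 'I_11) : wperm v i = word_nat v i :> nat.
Proof.
elim: v i => [|b v IH] i; first by rewrite perm1.
by rewrite /= permM IH letter_permE.
Qed.

Lemma wperm_eq u v :
  all (fun i => word_nat u i == word_nat v i) (iota 0 11) -> wperm u = wperm v.
Proof.
move=> /allP uv; apply/permP => i; apply: val_inj; rewrite /= !wpermE.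
by apply/eqP/uv; rewrite mem_iota /=.
Qed.

Lemma w2_perm2 : (w2_perm * w2_perm = 1)%g.
Proof.
have := @wperm_eq [:: true; true] [::] isT.
by rewrite /wperm /= mulg1.
Qed.

Lemma s_perm11 : (s_perm ^+ 11 = 1)%g.
Proof. by rewrite -(pword_nseq _ w2_perm); exact: (@wperm_eq (nseq 11 false) [::]). Qed.

Lemma s_permX k (i : 'I_11) : (s_perm ^+ k)%g i = (i + k) %% 11 :> nat.
Proof.
elim: k => [|k IH]; first by rewrite expg0 perm1 addn0 modn_small.
rewrite expgSr permM s_permE IH /s_nat addnS.
have := ltn_pmod (i + k) (isT : 0 < 11).
rewrite -[in RHS]addn1 -(modnDml (i + k)).
by case: ((i + k) %% 11) => [|[|[|[|[|[|[|[|[|[|[|n]]]]]]]]]]].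
Qed.

Lemma wperm_M11 v : wperm v \in M11.
Proof.
elim: v => [|b v IH]; first exact: group1.
rewrite /= groupM //; case: b; apply: mem_gen; rewrite !inE eqxx ?orbT //.
Qed.

(** * Subgroups of Sym(11) isomorphic to M11 *)

(** A relation between [s_perm] and [w2_perm] that does two jobs. On 11 points it leaves only the
    conjugates of [w2_perm] by powers of [s_perm] as candidates for the second generator; for
    monomial lifts, its rows give enough equations to solve for the entries of [w2]. *)
Definition M11_relator : seq bool := sylls [:: 0; 1; 1; 1; 5; 7].

Definition eval_table (L : seq nat) (v : seq bool) (i : nat) : nat :=
  foldl (fun j (b : bool) => if b then nth 0 L j else s_nat j) i v.

(* [L] lists the first values of an involution; [q] may come next. *)
Definition next_value (L : seq nat) (q : nat) : bool :=
  if q < size L then nth 0 L q == size L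
  else (q \notin L) && (size L \notin L).

Definition conj_w2_table (k : nat) : seq nat :=
  [seq word_nat (sylls [:: k; 11 - k]) i | i <- iota 0 11].

(** Backtracking over all involutions of the points (the identity included), with [n] values still
    to be chosen. A complete table must be that of a conjugate of [w2_perm] as soon as it satisfies
    the relation. *)
Fixpoint search (n : nat) (L : seq nat) : bool :=
  if n is n'.+1 then
    all (fun q => if next_value L q then search n' (rcons L q) else true)
        (iota 0 11)
  else if all (fun i => eval_table L M11_relator i == i) (iota 0 11)
  then L \in [seq conj_w2_table k | k <- iota 0 11] else true.

Lemma search_complete : search 11 [::].
Proof. by vm_cast_no_check (erefl true). Qed.

Section Search.

Variable w : 'S_11.
Hypothesis w_inv : (w * w = 1)%g.
Hypothesis w_rel : pword s_perm w M11_relator = 1%g.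

Let table k : seq nat := [seq nat_of_ord (w (o j)) | j <- iota 0 k].

Let size_table k : size (table k) = k.
Proof. by rewrite size_map size_iota. Qed.

Let nth_table k j : j < k -> nth 0 (table k) j = w (o j).
Proof. by move=> ltj; rewrite (nth_map 0) ?size_iota // nth_iota. Qed.

Let tableS k : table k.+1 = rcons (table k) (w (o k)).
Proof. by rewrite /table -[k.+1]addn1 iotaD map_cat cats1. Qed.

Let mem_table k j : k <= 11 -> j < 11 -> (j \in table k) = (w (o j) < k).
Proof.
move=> lek ltj; have wK (x : 'I_11) : w (w x) = x by rewrite -permM w_inv perm1.
apply/mapP/idP => [[x]|ltwj].
  rewrite mem_iota /= add0n => ltx jE.
  have -> : o j = w (o x) by apply: val_inj; rewrite val_o.
  by rewrite wK val_o // (leq_trans ltx).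
exists (nat_of_ord (w (o j))); first by rewrite mem_iota.
by rewrite /= o_val wK val_o.
Qed.

Let next_value_table k : k < 11 -> next_value (table k) (w (o k)).
Proof.
move=> ltk; rewrite /next_value size_table.
have wK (x : 'I_11) : w (w x) = x by rewrite -permM w_inv perm1.
case: ifP => [ltw|/negbT]; first by rewrite nth_table // o_val wK val_o.
have lek := ltnW ltk.
by rewrite -leqNgt !mem_table // ?o_val ?wK ?val_o ?ltnn -?leqNgt // => ->.
Qed.

Let eval_tableE v (i : 'I_11) : eval_table (table 11) v i = pword s_perm w v i.
Proof.
elim: v i => [|b v IH] i; first by rewrite perm1.
rewrite /= permM -IH; congr eval_table.
by case: b; rewrite ?s_permE // nth_table ?ltn_ord // o_val.
Qed.

Lemma search_sound n k : n + k = 11 -> search n (table k) ->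
  table 11 \in [seq conj_w2_table j | j <- iota 0 11].
Proof.
elim: n k => [|n IH] k; rewrite ?add0n.
  move=> ->; rewrite /search ifT; first by apply.
  apply/allP => i; rewrite mem_iota => lti.
  by rewrite -(val_o lti) eval_tableE w_rel perm1.
rewrite addSnnS => nk /allP srch.
apply: (IH k.+1 nk).
have ltk : k < 11 by rewrite -nk leq_addl.
have := srch (w (o k)); rewrite mem_iota ltn_ord next_value_table // => /(_ isT).
by rewrite tableS.
Qed.

Lemma relator_conj_w2 : exists k, w = (w2_perm ^ (s_perm ^+ k))%g.
Proof.
have /mapP [k + tabE] : table 11 \in [seq conj_w2_table j | j <- iota 0 11].
  exact: (@search_sound 11 0 erefl search_complete).
rewrite mem_iota /= add0n => ltk; exists (11 - k).
have -> : (w2_perm ^ (s_perm ^+ (11 - k)))%g = wperm (sylls [:: k; 11 - k]).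
  have -> : sylls [:: k; 11 - k] = nseq k false ++ [:: true] ++ nseq (11 - k) false.
    by [].
  rewrite /wperm !pwordM !pword_nseq /= mulg1 /conjg; congr (_ * _)%g.
  apply: (mulgI (s_perm ^+ (11 - k))%g).
  by rewrite mulgV -expgD subnK ?s_perm11 // ltnW.
apply/permP => i; apply: val_inj => /=; rewrite wpermE.
have := congr1 (nth 0 ^~ i) tabE.
by rewrite nth_table // o_val => ->; rewrite (nth_map 0) ?size_iota // nth_iota.
Qed.

End Search.

(** If a power [p ^+ d] with [0 < d < 11] fixed a point, so would [p], itself a power of [p ^+ d].
    Hence the orbit of any moved point has 11 elements and [p] is an 11-cycle; listing that orbit
    gives the conjugating permutation. *)
Lemma order11_conj_s (p : 'S_11) : #[p]%g = 11 -> exists x, (p ^ x)%g = s_perm.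
Proof.
move=> ordp.
have [i pi] : exists i, p i != i.
  apply/existsP; apply: contraT; rewrite negb_exists => /forallP pid.
  have p1 : p = 1%g by apply/permP => i; rewrite perm1; apply/eqP; rewrite -[_ == _]negbK.
  by rewrite p1 order1 in ordp.
have p11 : (p ^+ 11 = 1)%g by apply/eqP; rewrite -order_dvdn ordp.
have pXfix d : 0 < d < 11 -> (p ^+ d)%g i != i.
  move=> /andP [d0 d11]; apply: contra pi => /eqP pdi.
  have cop : coprime #|<[p]>%g| d.
    rewrite -orderE ordp prime_coprime //.
    by apply/negP => /(dvdn_leq d0); rewrite leqNgt d11.
  by rewrite -{1}(expgK cop (cycle_id p)) permX iter_fix.
pose f (k : 'I_11) := (p ^+ k)%g i.
have finj : injective f.
  suff lt_neq (a b : 'I_11) : a < b -> f a <> f b.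
    move=> a b fab; apply/val_inj.
    by case: (ltngtP a b) => // ltab; case: (lt_neq _ _ ltab).
  move=> ltab; rewrite /f -(subnK (ltnW ltab)) expgD permM => fab.
  have : (p ^+ (b - a))%g i != i.
    by apply: pXfix; rewrite subn_gt0 ltab (leq_ltn_trans (leq_subr _ _)).
  by rewrite -(perm_inj fab) eqxx.
exists (perm finj)^-1%g; apply: (canLR (conjgK _)).
apply: (mulgI (perm finj)); rewrite /conjg !mulgA mulgV mul1g.
apply/permP => k; rewrite !permM !(permE finj) /f. rewrite -permM -expgSr s_permE /s_nat.
by case: eqP => [->|//]; rewrite expg0 p11.
Qed.

Lemma order_s_perm : #[s_perm]%g = 11.
Proof.
apply/prime_nt_dvdP => //; last by rewrite order_dvdn s_perm11.
rewrite order_eq1; apply/eqP => /permP /(_ ord0) /(congr1 val).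
by rewrite /= s_permE perm1.
Qed.

(** The images of the generators under the isomorphism satisfy the same relations. One conjugation
    brings the image of [s_perm] to [s_perm]; the search then makes the image of [w2_perm] a
    conjugate by a power of [s_perm], which is undone without moving [s_perm]. *)
Lemma isog_M11_conj (P : {group 'S_11}) :
  P \isog M11 -> exists x, (P :^ x = M11)%g.
Proof.
rewrite isog_sym => /isogP [f injf fM11].
have sM : s_perm \in M11 by apply: mem_gen; rewrite !inE eqxx.
have wM : w2_perm \in M11 by apply: mem_gen; rewrite !inE eqxx orbT.
have pwordf v : pword (f s_perm) (f w2_perm) v = f (wperm v).
  elim: v => [|b v IH]; first by rewrite morph1.
  by rewrite /= IH; case: b; rewrite -morphM ?wperm_M11.
have [x fs] : exists x, (f s_perm ^ x)%g = s_perm.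
  by apply: order11_conj_s; rewrite order_injm // order_s_perm.
have [k fw] : exists k, (f w2_perm ^ x)%g = (w2_perm ^ (s_perm ^+ k))%g.
  apply: relator_conj_w2.
    by rewrite -conjMg -morphM // w2_perm2 morph1 conj1g.
  rewrite -{1}fs pwordJ pwordf (_ : wperm _ = 1%g) ?morph1 ?conj1g //.
  exact: (@wperm_eq M11_relator [::] isT).
exists (x * s_perm ^- k)%g.
rewrite -fM11 {1}/M11 morphim_gen; last first.
  by apply/fintype.subsetP => y; rewrite !inE => /orP [] /eqP ->.
rewrite -genJ /M11; congr (<< _ >>)%g.
rewrite morphimEsub; last first.
  by apply/fintype.subsetP => y; rewrite !inE => /orP [] /eqP ->.
rewrite imsetU1 imset_set1 conjUg !conjg_set1 /=.
rewrite !conjgM fs fw conjgK; congr (_ |: _)%SET.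
by rewrite conjgE invgK mulgA -expgSr expgS mulgK.
Qed.

(** As [s_perm] is transitive and normalises N, all N-orbits have the same size, a divisor of 11. A
    nontrivial N is therefore transitive and, being abelian, regular of order 11. It contains
    [s_perm], for otherwise a group of order 121 would act on 11 points. Then [s_perm] would commute
    with its conjugate by [w2_perm], which evaluation at one point refutes. *)
Lemma M11_abelian_normal_trivial (N : {group 'S_11}) :
  abelian N -> s_perm \in 'N(N)%g -> w2_perm \in 'N(N)%g -> N :=: 1%g.
Proof.
move=> abN nNs nNw; apply/eqP; apply: contraT => N1.
have [n nN [i ni]] : exists2 n, n \in N & exists i, n i != i.
  have [n nN n1] := trivgPn _ N1; exists n => //.
  apply/existsP; apply: contraR n1; rewrite negb_exists => /forallP nid.
  by apply/eqP/permP => i; rewrite perm1; apply/eqP; rewrite -[_ == _]negbK.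
have cardC j : #|'C_N[j | 'P]%g| = #|'C_N[ord0 | 'P]%g|.
  have step (l : 'I_11) : #|'C_N[s_perm l | 'P]%g| = #|'C_N[l | 'P]%g|.
    have -> : s_perm l = 'P%act l s_perm by [].
    by rewrite astab1_act -{1}(normP nNs) -conjIg cardJg.
  have -> : j = (s_perm ^+ j)%g ord0.
    by apply: val_inj; rewrite /= s_permX add0n modn_small.
  by elim: (nat_of_ord j) => [|m IH]; rewrite ?expg0 ?perm1 // expgSr permM step.
have orb_card j : #|orbit 'P N j| = #|orbit 'P N ord0|.
  have := card_orbit_stab 'P N j; rewrite -(card_orbit_stab 'P N ord0) cardC.
  by move/eqP; rewrite eqn_pmul2r ?cardG_gt0 // => /eqP.
have orb_dvd : #|orbit 'P N ord0| %| 11.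
  have aN : [acts N, on [set: 'I_11] | 'P] by apply/actsP => a _ x; rewrite !inE.
  have := acts_sum_card_orbit aN; rewrite cardsT card_ord => sum11.
  rewrite -[X in _ %| X]sum11 (eq_bigr (fun=> #|orbit 'P N ord0|)).
    by rewrite sum_nat_const dvdn_mull.
  by move=> T /imsetP [x _ ->].
have orb11 : #|orbit 'P N ord0| = 11.
  apply/prime_nt_dvdP => //; rewrite -(orb_card i); apply/eqP => /eqP/cards1P [x xE].
  have : i \in orbit 'P N i by exact: orbit_refl.
  have : n i \in orbit 'P N i by apply/orbitP; exists n.
  by rewrite !{1}xE !inE => /eqP nix /eqP ix; case/eqP: ni; rewrite nix ix.
have fix1 (m : 'S_11) j : m \in N -> m j = j -> m = 1%g.
  move=> mN mj; apply/permP => x; rewrite perm1.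
  have : x \in orbit 'P N j.
    suff -> : orbit 'P N j = [set: 'I_11] by [].
    by apply/eqP; rewrite eqEcard finset.subsetT cardsT card_ord orb_card orb11.
  case/orbitP => k kN <-; rewrite /= /aperm -!permM.
  by rewrite (centsP abN _ kN _ mN) permM mj.
have cardN : #|N| = 11.
  rewrite -(card_orbit_stab 'P N ord0) orb11 (_ : 'C_N[_ | _]%g = 1%g) ?cards1 //.
  apply/trivgP/fintype.subsetP => m; rewrite inE => /andP [mN /astab1P m0].
  by rewrite inE (fix1 m ord0).
have sN : s_perm \in N.
  apply: contraT => sN.
  have ords : #|<[s_perm]>%g| = 11 by exact: order_s_perm.
  have TI : (<[s_perm]> :&: N = 1)%g.
    by apply: prime_TIg; rewrite ?ords // cycle_subG.
  have := cardSg (finset.subsetT (<[s_perm]> <*> N)%G).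
  rewrite /= norm_joinEl ?cycle_subG // TI_cardMg // ords cardN.
  rewrite cardsT card_Sn factS dvdn_pmul2l; last by [].
  (* Order 121 would force 11 to divide [10!], while Wilson's theorem makes it divide [10! + 1]. *)
  have : (11 %| (10`!).+1) = prime 11 := esym (@Wilson 11 isT).
  by move: (10`!) => f; rewrite -[f.+1]addn1 => fE f11; rewrite dvdn_addr in fE.
have swN : (s_perm ^ w2_perm)%g \in N by rewrite -(normP nNw) memJ_conjg.
have w2V : (w2_perm^-1 = w2_perm)%g.
  by apply: (mulgI w2_perm); rewrite mulgV w2_perm2.
have := centsP abN _ sN _ swN; rewrite /commute conjgE w2V !mulgA.
move=> sw; have : wperm [:: false; true; false; true] =
                  wperm [:: true; false; true; false].
  by rewrite /wperm /= !mulg1 !mulgA.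
by move/(congr1 (fun p : 'S_11 => nat_of_ord (p ord0))); rewrite !wpermE.
Qed.

(** * The transposition (0 1) from elements of M11 *)

Definition tperm01_plus : seq (seq nat) :=
  [:: [:: 0]; [:: 5; 5; 3]; [:: 2; 2; 2; 1]; [:: 0; 1; 1; 3; 2; 1; 1];
      [:: 0; 3; 3; 0]; [:: 3; 2; 6; 1; 0]; [:: 1; 1; 1; 3]; [:: 1; 1; 2; 2];
      [:: 8; 4; 1; 4]; [:: 2; 1; 1; 2; 1]; [:: 8; 3]; [:: 4; 1; 8];
      [:: 4; 1; 5; 3]; [:: 0; 5; 2; 4; 1]; [:: 0; 1; 1; 4; 3; 1; 0];
      [:: 1; 2; 5; 3; 1; 1]].
Definition tperm01_minus : seq (seq nat) :=
  [:: [:: 8; 1; 2]; [:: 0; 2; 1; 4; 1; 0]; [:: 1; 1; 3; 1; 1; 1; 0];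
      [:: 2; 4; 3; 2; 1]; [:: 2; 3; 2; 5; 0]; [:: 1; 2; 2; 1; 2; 3];
      [:: 0; 1; 2; 1; 1; 2; 4]; [:: 4; 3; 2; 2; 4]; [:: 4; 4; 1; 2];
      [:: 1; 2; 1; 2; 3; 3; 1]; [:: 0; 2; 3; 1; 1; 2]; [:: 0; 3; 1; 1; 3; 1; 1];
      [:: 0; 1; 4; 1; 5; 0]; [:: 4; 1; 1; 4; 1; 2]; [:: 6; 1; 2; 0]].

(* The permutation matrices satisfy [(0 1) + \sum minus = \sum plus]: with [h]
   in a subgroup of order 9 (resp. 8) fixing 0 and 1 and regular on nine (resp.
   eight) other points, and [g] exchanging 0 and 1, [\sum_h (h - h g)] is
   9 (resp. 8) times [1 - (0 1)]. *)
Lemma tperm01_prod (F : comPzRingType) (a : 'I_11 -> F) (i : 'I_11) :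
  (\prod_(l <- tperm01_plus) a (wperm (sylls l) i) =
   a (tperm (o 0) (o 1) i) * \prod_(l <- tperm01_minus) a (wperm (sylls l) i))%R.
Proof.
pose p := [seq wperm (sylls l) i | l <- tperm01_plus].
pose m := [seq wperm (sylls l) i | l <- tperm01_minus].
(* Row [i] of the matrix identity is an equality of multisets of images of [i], which a product over
   [a] cannot distinguish. *)
have pm : perm_eq p (tperm (o 0) (o 1) i :: m).
  have valE L : map (@nat_of_ord 11) [seq wperm (sylls l) i | l <- L] =
                [seq word_nat (sylls l) i | l <- L].
    by rewrite -map_comp; apply: eq_map => l /=; rewrite wpermE.
  apply: (perm_map_inj (@ord_inj 11)).
  rewrite (map_cons _ (tperm (o 0) (o 1) i)) !valE tperm_val //.
  move: i {p m valE}; apply: (@forall_ord11 (fun k =>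
    perm_eq [seq word_nat (sylls l) k | l <- tperm01_plus]
      ((if k == 0 then 1 else if k == 1 then 0 else k) ::
       [seq word_nat (sylls l) k | l <- tperm01_minus]))); apply/allP.
  by vm_compute.
by rewrite -(big_map (fun l => wperm (sylls l) i) xpredT) (perm_big _ pm) big_cons big_map.
Qed.

(** Conjugating (0 1) by powers of [s_perm] gives the adjacent transpositions, hence all
    transpositions. Closure under products suffices, because every inverse taken on the way is that
    of an element of M11 or of a transposition. *)
Lemma gen_M11_tperm (P : 'S_11 -> Prop) :
  (forall x y, P x -> P y -> P (x * y)%g) ->
  (forall x, x \in M11 -> P x) -> P (tperm (o 0) (o 1)) -> forall x, P x.
Proof.
move=> PM PM11 P01.
have PJ t x : P t -> x \in M11 -> P (t ^ x)%g.
  move=> Pt xM; rewrite conjgE.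
  by apply: (PM); [apply: PM11; rewrite groupV | apply: (PM) => //; exact: PM11].
have sM : s_perm \in M11 by apply: mem_gen; rewrite !inE eqxx.
have sXo k j : k + j < 11 -> (s_perm ^+ k)%g (o j) = o (k + j).
  move=> lt; have ltj := leq_ltn_trans (leq_addl k j) lt.
  by apply: val_inj; rewrite /= s_permX !inordK // addnC modn_small.
have Padj k : k.+1 < 11 -> P (tperm (o k) (o k.+1)).
  move=> ltk; have := PJ _ _ P01 (groupX k sM).
  by rewrite tpermJ !sXo ?addn0 ?addn1 // ltnW.
have P0 k : k < 11 -> P (tperm (o 0) (o k)).
  elim: k => [_|k IH ltk]; first by rewrite tperm1; apply: PM11; exact: group1.
  case: k IH ltk => [//|k] IH ltk.
  have Pk := IH (ltnW ltk); have Pa := Padj _ ltk.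
  have -> : tperm (o 0) (o k.+2) = (tperm (o 0) (o k.+1) ^ tperm (o k.+1) (o k.+2))%g.
    rewrite tpermJ tpermL tpermD //; apply/eqP => /(congr1 val);
      by rewrite !val_o // ltnW.
  by rewrite conjgE tpermV; apply: (PM) => //; exact: PM.
have Pt x y : P (tperm x y).
  have [->|nxy] := eqVneq x y; first by rewrite tperm1; apply: PM11; exact: group1.
  have [->|x0] := eqVneq x (o 0); first by rewrite -(o_val y); apply: P0; exact: ltn_ord.
  have P0x : P (tperm (o 0) x) by rewrite -(o_val x); apply: P0; exact: ltn_ord.
  have P0y : P (tperm (o 0) y) by rewrite -(o_val y); apply: P0; exact: ltn_ord.
  have [->|y0] := eqVneq y (o 0); first by rewrite tpermC.
  have -> : tperm x y = (tperm (o 0) y ^ tperm (o 0) x)%g.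
    by rewrite tpermJ tpermL tpermD // eq_sym.
  by rewrite conjgE tpermV; apply: (PM) => //; exact: PM.
move=> x; have [ts -> _] := prod_tpermP x.
elim: ts => [|[u v] ts IH]; first by rewrite big_nil; apply: PM11; exact: group1.
by rewrite big_cons; apply: PM.
Qed.

(** * Signed words *)

(* The sign of row [i] of [w2_mx *m d_mx 1]. *)
Definition w2_sign (i : nat) : bool :=
  nth false [:: true; true; true; false; true; true; false; true] i.

Fixpoint word_sign (v : seq bool) (i : nat) : bool :=
  if v is b :: v' then (b && w2_sign i) (+) word_sign v' (letter_nat b i)
  else false.

(* Representatives, up to cyclic shifts, of 66 words of weight 5 of a ternary
   Golay code of length 11, over {0, 1, 2}. The signed permutation matrices of
   the letters permute the 66 words, whose supports are pairwise distinct. *)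
Definition golay_words : seq (seq nat) :=
  flatten [seq [seq rot k c | k <- iota 0 11] | c <-
    [:: [:: 0; 0; 0; 0; 0; 2; 2; 1; 2; 0; 1];
        [:: 0; 0; 0; 0; 1; 2; 0; 0; 1; 2; 2];
        [:: 0; 0; 0; 1; 0; 0; 1; 0; 1; 1; 1];
        [:: 0; 0; 0; 1; 1; 0; 2; 2; 0; 0; 2];
        [:: 0; 0; 0; 2; 0; 1; 0; 2; 0; 2; 1];
        [:: 0; 0; 2; 0; 2; 0; 0; 2; 1; 0; 1]]].

Definition flip3 (b : bool) (x : nat) : nat :=
  if b then nth 0 [:: 0; 2; 1] x else x.

Definition word_act (v : seq bool) (c : seq nat) : seq nat :=
  [seq flip3 (word_sign v i) (nth 0 c (word_nat v i)) | i <- iota 0 11].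

Lemma letter_act_golay :
  all (fun c => all (fun b => word_act [:: b] c \in golay_words)
                    [:: false; true]) golay_words.
Proof. by vm_cast_no_check (erefl true). Qed.

Lemma golay_words_lt3 :
  all (fun c => (size c == 11) && all (fun x => x < 3) c) golay_words.
Proof. by vm_cast_no_check (erefl true). Qed.

Lemma golay_supports :
  all (fun c => all (fun c' =>
    ([seq x == 0 | x <- c'] == [seq x == 0 | x <- c]) ==> (c' == c))
    golay_words) golay_words.
Proof. by vm_cast_no_check (erefl true). Qed.

Lemma golay_cover :
  all (fun i => has (fun c => nth 0 c i != 0) golay_words) (iota 0 11).
Proof. by vm_cast_no_check (erefl true). Qed.

Lemma letter_nat_lt b i : i < 11 -> letter_nat b i < 11.
Proof. by case: b; move: i => [|[|[|[|[|[|[|[|[|[|[|k]]]]]]]]]]]. Qed.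

Lemma golay_nth_lt3 c i : c \in golay_words -> nth 0 c i < 3.
Proof.
move=> cG; have /andP [_ /allP c3] := allP golay_words_lt3 _ cG.
by have [ltic|?] := ltnP i (size c); [apply/c3/mem_nth | rewrite nth_default].
Qed.

Lemma flip3_add a b x : x < 3 -> flip3 (a (+) b) x = flip3 a (flip3 b x).
Proof. by case: a; case: b; move: x => [|[|[|]]]. Qed.

Lemma word_act_golay v c : c \in golay_words -> word_act v c \in golay_words.
Proof.
move=> cG; elim: v => [|b v IH].
  suff -> : word_act [::] c = c by [].
  have /andP [/eqP szc _] := allP golay_words_lt3 _ cG.
  by rewrite -[RHS](mkseq_nth 0) szc.
suff -> : word_act (b :: v) c = word_act [:: b] (word_act v c).
  by have /allP := allP letter_act_golay _ IH; apply; case: (b).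
apply/eq_in_map => i; rewrite mem_iota /= => lti.
have ltbi := letter_nat_lt b lti.
rewrite addbF (nth_map 0) ?size_iota // nth_iota // flip3_add //.
exact: golay_nth_lt3.
Qed.

(** A word fixing all points changes a codeword only by signs, so it keeps the support; as supports
    are pairwise distinct, it keeps the codeword. A sign change would exchange 1 and 2, so there is
    none on the support, and the supports cover all points. *)
Lemma word_sign_id v : (forall i, i < 11 -> word_nat v i = i) ->
  forall i, i < 11 -> word_sign v i = false.
Proof.
move=> vid i lti.
have /hasP [c cG ci] : has (fun c => nth 0 c i != 0) golay_words.
  by apply: (allP golay_cover); rewrite mem_iota.
have vcG := word_act_golay v cG.
have /andP [/eqP szc _] := allP golay_words_lt3 _ cG.
have /implyP supp := allP (allP golay_supports _ cG) _ vcG.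
have nth_act j : j < 11 -> nth 0 (word_act v c) j = flip3 (word_sign v j) (nth 0 c j).
  by move=> ltj; rewrite (nth_map 0) ?size_iota // nth_iota // vid.
have /eqP/(congr1 (nth 0 ^~ i)) : word_act v c == c.
  apply/supp/eqP; apply: (@eq_from_nth _ false); rewrite !size_map size_iota ?szc // => j ltj.
  rewrite !(nth_map 0) ?size_map ?size_iota ?szc // nth_iota // vid // add0n.
  by have := golay_nth_lt3 j cG; case: (word_sign v j); case: (nth 0 c j) => [|[|[|]]].
rewrite /= nth_act //; have := golay_nth_lt3 i cG; move: ci.
by case: (word_sign v i); case: (nth 0 c i) => [|[|[|]]].
Qed.

(* As a signed matrix the letter [b] is [u v u^-1 v^-1], (u, v) = comm_words b. *)
Definition comm_words (b : bool) : seq bool * seq bool :=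
  if b then (sylls [:: 1; 2; 2], sylls [:: 3; 3; 1])
  else (sylls [:: 1; 1; 1; 2; 2], sylls [:: 1; 0]).

Lemma comm_wordsP b :
  let: (u, v) := comm_words b in
  all (fun i => (word_nat (b :: v ++ u) i == word_nat (u ++ v) i) &&
                (word_sign (b :: v ++ u) i == word_sign (u ++ v) i)) (iota 0 11).
Proof. by case: b; vm_compute. Qed.

(* The words in a subgroup of order 9 fixing 0 and 1 and regular on the other
   points, and their products with an element fixing 0 with sign 1 and whose
   signs make the other entries of the sum of the signed matrices cancel. *)
Definition e00_words : seq (seq nat) :=
  [:: [:: 0]; [:: 8; 1; 2]; [:: 0; 2; 1; 4; 1; 0]; [:: 1; 1; 3; 1; 1; 1; 0];
      [:: 2; 4; 3; 2; 1]; [:: 2; 3; 2; 5; 0]; [:: 1; 2; 2; 1; 2; 3];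
      [:: 0; 1; 2; 1; 1; 2; 4]; [:: 4; 3; 2; 2; 4]; [:: 2; 1; 1; 2; 1];
      [:: 1; 1; 4; 1; 1; 1; 1]; [:: 3; 1; 1; 1; 2; 1; 3; 0];
      [:: 0; 1; 5; 1; 3; 2]; [:: 1; 3; 2; 1; 1; 2]; [:: 0; 2; 2; 2; 1; 1; 2; 0];
      [:: 0; 1; 1; 1; 4; 3; 3]; [:: 5; 1; 7]; [:: 1; 3; 2; 4]].

Lemma e00_wordsP :
  all (fun i => all (fun j =>
    count (fun l => (word_nat (sylls l) i == j) && ~~ word_sign (sylls l) i) e00_words
    == (if (i == 0) && (j == 0) then 18 else 0) +
       count (fun l => (word_nat (sylls l) i == j) && word_sign (sylls l) i) e00_words)
   (iota 0 11)) (iota 0 11).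
Proof. by vm_cast_no_check (erefl true). Qed.

Local Open Scope ring_scope.

(** * Monomial matrices *)

Section Monomial.
Variable F : fieldType.
Implicit Types (d e f : 'I_11 -> F) (a c : 'S_11) (v : seq bool).

Definition mon d a : 'M[F]_11 := diag_mx (\row_i d i) *m perm_mx a.

Lemma monE d a i j : mon d a i j = if a i == j then d i else 0.
Proof.
rewrite /mon mul_diag_mx !mxE.
by case: eqP => _; rewrite ?mulr1 ?mulr0.
Qed.

Lemma diag_perm_mon (r : 'rV[F]_11) a : diag_mx r *m perm_mx a = mon (fun i => r 0 i) a.
Proof. by congr (diag_mx _ *m _); apply/rowP => i; rewrite mxE. Qed.

Lemma eq_mon d e a : d =1 e -> mon d a = mon e a.
Proof. by move=> de; apply/matrixP => i j; rewrite !monE de. Qed.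

Lemma sub_eq_mon (P : 'M[F]_11 -> Prop) d e a : P (mon d a) -> d =1 e -> P (mon e a).
Proof. by move=> Pd de; rewrite -(eq_mon a de). Qed.

Lemma mon_mul d a e c : mon d a *m mon e c = mon (fun i => d i * e (a i)) (a * c)%g.
Proof.
apply/matrixP => i j; rewrite [RHS]monE mxE (bigD1 (a i)) //= big1 ?addr0 => [|k kai].
  by rewrite !monE eqxx permM; case: eqP => _ //; rewrite mulr0.
by rewrite monE eq_sym (negPf kai) mul0r.
Qed.

Lemma mon1 : mon (fun=> 1) 1 = 1%:M.
Proof. by apply/matrixP => i j; rewrite monE perm1 [RHS]mxE; case: eqP. Qed.

Lemma perm_mx_mon a : perm_mx a = mon (fun=> 1) a.
Proof. by apply/matrixP => i j; rewrite [RHS]monE !mxE; case: eqP. Qed.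

Lemma det_mon d a : \det (mon d a) = (-1) ^+ a * \prod_i d i.
Proof.
rewrite /mon det_mulmx det_diag det_perm mulrC; congr (_ * _).
by apply: eq_bigr => i _; rewrite mxE.
Qed.

Lemma mon_unit d a : (forall i, d i != 0) -> mon d a \in unitmx.
Proof.
by move=> d0; rewrite unitmxE det_mon unitrMl ?unitfE ?signr_eq0 //; apply/prodf_neq0.
Qed.

Lemma mon_inj d a e c : (forall i, d i != 0) ->
  mon d a = mon e c -> a = c /\ d =1 e.
Proof.
move=> d0 /matrixP de.
have ab i : c i = a i.
  have := de i (a i); rewrite !monE eqxx; case: eqP => // _ di0.
  by move: (d0 i); rewrite di0 eqxx.
split=> [|i]; first by apply/permP => i; rewrite ab.
by have := de i (a i); rewrite !monE ab eqxx.
Qed.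

Lemma invmx_mon d a : (forall i, d i != 0) ->
  invmx (mon d a) = mon (fun i => (d ((a^-1)%g i))^-1) (a^-1)%g.
Proof.
move=> d0; apply: (can_inj (mulKmx (mon_unit a d0))).
rewrite mulmxV ?mon_unit // mon_mul mulgV -mon1.
by apply: eq_mon => i; rewrite permK divff.
Qed.

Lemma mon_conj_perm d a : invmx (perm_mx a) *m mon d 1 *m perm_mx a =
  mon (fun i => d ((a^-1)%g i)) 1.
Proof.
rewrite !perm_mx_mon invmx_mon => [|i]; last exact: oner_neq0.
by rewrite !mon_mul mulg1 mulVg; apply: eq_mon => i; rewrite invr1 mul1r mulr1.
Qed.

Lemma mon_conj_diag f d a : (forall i, f i != 0) ->
  invmx (mon f 1) *m mon d a *m mon f 1 = mon (fun i => (f i)^-1 * d i * f (a i)) a.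
Proof.
move=> f0; rewrite invmx_mon // !mon_mul invg1 mulg1 mul1g.
by apply: eq_mon => i; rewrite !perm1.
Qed.

Lemma mon_sub1 d : mon d 1 - 1%:M = mon (fun i => d i - 1) 1.
Proof.
rewrite -mon1; apply/matrixP => i j; rewrite [LHS]mxE [X in _ + X]mxE !monE.
by case: eqP => _; rewrite ?subr0.
Qed.

Lemma mon_e00 (x : F) : mon (fun i => if i == 0 then x else 0) 1 = x *: delta_mx 0 0.
Proof.
apply/matrixP => i j; rewrite monE perm1 [RHS]mxE mxE [j == 0]eq_sym.
case: (eqVneq i 0) => [->|_]; case: eqP => _; rewrite ?mulr1 ?mulr0 //.
Qed.

Lemma is_diag_mon d : is_diag_mx (mon d 1).
Proof. by apply/is_diag_mxP => i j ij; rewrite monE perm1 (negPf (_ : i != j)). Qed.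

Lemma diag_mon (M : 'M[F]_11) : is_diag_mx M -> M = mon (fun i => M i i) 1.
Proof.
move/is_diag_mxP => dM; apply/matrixP => i j; rewrite monE perm1.
by case: eqP => [->//|/eqP ij]; apply: dM.
Qed.

Lemma mon_is_diag d a : (forall i, d i != 0) -> is_diag_mx (mon d a) -> a = 1%g.
Proof.
by move=> d0 /diag_mon /(mon_inj d0) [].
Qed.

Lemma unit_diag_neq0 (M : 'M[F]_11) i : M \in unitmx -> is_diag_mx M -> M i i != 0.
Proof.
rewrite unitmxE unitfE => detM /diag_mon ME; move: detM.
by rewrite {1}ME det_mon perm.odd_perm1 mul1r => /prodf_neq0; apply.
Qed.

(** The nonzero entry in row [i] of a word in two monomial matrices: the product of the entries met
    along the path of [i] under the letters. *)
Fixpoint weight (y x : nat -> F) v (i : nat) : F :=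
  if v is b :: v' then (if b then x i else y i) * weight y x v' (letter_nat b i)
  else 1.

Definition letter_mx (y x : nat -> F) (b : bool) : 'M[F]_11 :=
  mon (fun i => if b then x i else y i) (if b then w2_perm else s_perm).

Definition word_mx (y x : nat -> F) v : 'M[F]_11 :=
  foldr (fun b M => letter_mx y x b *m M) 1%:M v.

Lemma word_mx_cat y x u v : word_mx y x (u ++ v) = word_mx y x u *m word_mx y x v.
Proof. by elim: u => [|b u IH] /=; rewrite ?mul1mx // IH mulmxA. Qed.

Lemma word_mxE y x v : word_mx y x v = mon (fun i => weight y x v i) (wperm v).
Proof.
elim: v => [|b v IH]; first by rewrite /= -mon1.
by rewrite /= IH mon_mul; apply: eq_mon => i; rewrite letter_permE.
Qed.

Lemma weight_neq0 y x v i : (forall k, (k < 11)%N -> y k != 0) ->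
  (forall k, (k < 11)%N -> x k != 0) -> (i < 11)%N -> weight y x v i != 0.
Proof.
move=> y0 x0; elim: v i => [|b v IH] i lti /=; first exact: oner_neq0.
by rewrite mulf_neq0 ?IH ?letter_nat_lt //; case: b; auto.
Qed.

(** The unknown entries enter the m-th power only through the numbers of letters of each kind. Two
    words with the same letter counts thus differ, after m-th powers, by a sign that can be
    computed. *)
Lemma weight_exp y x v i m cy cx z : z * z = 1 ->
  (forall k, (k < 11)%N -> y k ^+ m = cy) ->
  (forall k, (k < 11)%N -> x k ^+ m = cx * (if w2_sign k then z else 1)) ->
  (i < 11)%N ->
  weight y x v i ^+ m = cy ^+ count negb v * cx ^+ count id v *
                        (if word_sign v i then z else 1).
Proof.
move=> zz ym xm; elim: v i => [|b v IH] i lti /=; first by rewrite expr1n !mul1r.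
rewrite exprMn IH ?letter_nat_lt //; case: b => /=; rewrite add0n exprS.
  rewrite xm //; set p := cy ^+ _; set q := cx ^+ _.
  case: (w2_sign i); case: (word_sign v _) => /=; try by ring.
  have -> : cx * z * (p * q * z) = p * (cx * q) * (z * z) by ring.
  by rewrite zz.
by rewrite ym // !mulrA.
Qed.

End Monomial.

Local Open Scope classical_set_scope.

(** * Finite groups of diagonal matrices *)

(** Lagrange's argument: [g] permutes [s] and multiplies each factor of the nonzero product of the
    [f y] by [x], so that product equals itself times [x ^+ size s]. *)
Lemma mul_inj_expr_size (F : fieldType) (T : eqType) (s : seq T) (g : T -> T)
    (f : T -> F) (x : F) : uniq s ->
  {in s &, injective g} -> {in s, forall y, g y \in s} ->
  {in s, forall y, f y != 0} -> {in s, forall y, f (g y) = x * f y} ->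
  x ^+ size s = 1.
Proof.
move=> us injg gs f0 fg.
have ps : perm_eq (map g s) s.
  have um : uniq (map g s) by rewrite map_inj_in_uniq.
  have ms : {subset map g s <= s} by move=> _ /mapP [y ys ->]; apply: gs.
  have [|_ ms'] := uniq_min_size um ms; first by rewrite size_map.
  by apply: uniq_perm.
have P0 : \prod_(y <- s) f y != 0 by rewrite prodf_seq_neq0; apply/allP.
apply: (mulIf P0); rewrite mul1r -[RHS](perm_big _ ps) /= big_map.
rewrite [RHS](eq_big_seq (fun y => x * f y)) //.
by rewrite big_split /= big_const_seq count_predT iter_mulr_1.
Qed.

(** The witness is the number of elements of [E]. Each of them is a root of [X^m - 1] by the
    preceding lemma, and that polynomial has no room for another root. *)
Lemma finite_roots_of_unity (F : closedFieldType) (E : F -> Prop) (N : nat) :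
  (0 < N)%N -> E 1 -> (forall x y, E x -> E y -> E (x * y)) ->
  (forall x, E x -> x ^+ N = 1) ->
  exists2 m, (0 < m)%N & forall x, E x <-> x ^+ m = 1.
Proof.
move=> N0 E1 EM EN.
have [r rE] := closed_field_poly_normal ('X^N - 1 : {poly F}).
pose s := [seq x <- undup r | `[< E x >]].
have sE x : x \in s <-> E x.
  rewrite mem_filter mem_undup; split=> [/andP [/asboolP]//|Ex].
  apply/andP; split; first exact/asboolP.
  have : root ('X^N - 1) x by rewrite rootE !hornerE EN // subrr.
  rewrite rE rootZ ?root_prod_XsubC // lead_coefXnsubC //; exact: oner_neq0.
have us : uniq s by rewrite filter_uniq ?undup_uniq.
have nz x : E x -> x != 0.
  by move/EN/eqP; apply: contraTneq => ->; rewrite expr0n gtn_eqF // eq_sym oner_neq0.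
have sm x : E x -> x ^+ size s = 1.
  move=> Ex; apply: (@mul_inj_expr_size _ _ s ( *%R x) id) => //.
  - by move=> y z _ _; apply/mulfI/nz.
  - by move=> y /sE Ey; apply/sE/EM.
  - by move=> y /sE; apply: nz.
have s0 : (0 < size s)%N by have/sE : E 1 by []; case: (s).
exists (size s) => // x; split=> [/sm //|xm].
apply/sE; apply: contraT => xs.
have := @max_unity_roots F (size s) (x :: s) s0.
rewrite /= xs us ltnn => -> //.
apply/andP; split; first exact/unity_rootP.
by apply/allP => y /sE/sm ym; apply/unity_rootP.
Qed.

Section DiagonalGroups.

Variable R : realType.
Notation C := R[i].
Variable A : set 'M[C]_11.
Hypothesis (dA : diag_grp A) (finA : finite_set A).
Implicit Types d e : 'I_11 -> C.

Lemma diag_grp_mon a : A a -> a = mon (fun i => a i i) 1.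
Proof. by case: dA => _ diagA /diagA /diag_mon. Qed.

Lemma diag_grp_neq0 d i : A (mon d 1) -> d i != 0.
Proof.
case: dA => -[_ uA _ _] _ /uA.
rewrite unitmxE unitfE det_mon perm.odd_perm1 mul1r => /prodf_neq0; exact.
Qed.

Lemma diag_grp1 : A (mon (fun=> 1) 1).
Proof. by rewrite mon1; case: dA => -[]. Qed.

Lemma diag_grpM d e : A (mon d 1) -> A (mon e 1) -> A (mon (fun i => d i * e i) 1).
Proof.
move=> Ad Ae; case: dA => -[_ _ mulA _] _; have := mulA _ _ Ad Ae.
rewrite mon_mul mulg1 => Ade; apply: (sub_eq_mon Ade) => i.
by rewrite perm1.
Qed.

Lemma diag_grpV d : A (mon d 1) -> A (mon (fun i => (d i)^-1) 1).
Proof.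
move=> Ad; case: dA => -[_ _ _ invA] _; have := invA _ Ad.
rewrite invmx_mon; last by move=> i; apply: diag_grp_neq0.
by rewrite invg1 => Ad'; apply: (sub_eq_mon Ad') => i; rewrite perm1.
Qed.

Lemma diag_grp_prod (I : Type) (r : seq I) (P : pred I) (f : I -> 'I_11 -> C) :
  (forall i, P i -> A (mon (f i) 1)) ->
  A (mon (fun k => \prod_(i <- r | P i) f i k) 1).
Proof.
move=> Af; elim: r => [|i r IH].
  by apply: (sub_eq_mon diag_grp1) => k; rewrite big_nil.
case Pi : (P i); last first.
  by apply: (sub_eq_mon IH) => k; rewrite big_cons Pi.
apply: (sub_eq_mon (diag_grpM (Af _ Pi) IH)) => k. 
by rewrite big_cons Pi.
Qed.

Lemma diag_grp_exponent :
  exists2 N, (0 < N)%N & forall d, A (mon d 1) -> forall i, d i ^+ N = 1.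
Proof.
have [s sE] := (iffLR (finite_seqP A)) finA.
have sA a : a \in undup s <-> A a by rewrite mem_undup sE.
exists (size (undup s)).
  by case: (undup s) (iffRL (sA _) diag_grp1).
case: dA => -[_ uA mulA _] _.
move=> d Ad i; apply: (@mul_inj_expr_size _ _ _ (mulmx (mon d 1)) (fun a => a i i)).
- exact: undup_uniq.
- by move=> a b _ _; apply: (can_inj (mulKmx (uA _ Ad))).
- by move=> a /sA Aa; apply/sA/mulA.
- move=> a /sA Aa; rewrite (diag_grp_mon Aa) monE perm1 eqxx.
  by apply: (@diag_grp_neq0 (fun i => a i i)); rewrite -(diag_grp_mon Aa).
- by move=> a /sA Aa; rewrite {1}(diag_grp_mon Aa) mon_mul monE mulg1 !perm1 eqxx.
Qed.

Lemma Sym_invariantP : Sym_invariant A <->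
  forall (t : 'S_11) d, A (mon d 1) -> A (mon (fun i => d (t i)) 1).
Proof.
split=> [symA t d Ad|symA t a Aa].
  have := symA (t^-1)%g _ Ad; rewrite mon_conj_perm => Ad'.
  by apply: (sub_eq_mon Ad') => i; rewrite invgK.
rewrite (diag_grp_mon Aa) mon_conj_perm.
by apply: (symA _ (fun i => a i i)); rewrite -(diag_grp_mon Aa).
Qed.

(** Written multiplicatively, the identity for (0 1) makes the transposed diagonal a quotient of two
    products of its images under M11, all of which lie in A. *)
Lemma M11_invariant_Sym :
  (forall (t : 'S_11) d, t \in M11 -> A (mon d 1) -> A (mon (fun i => d (t i)) 1)) ->
  Sym_invariant A.
Proof.
move=> M11A; apply/Sym_invariantP => t d; move: t d.
apply: gen_M11_tperm => [x y Ax Ay d Ad|x xM d Ad|d Ad].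
- by apply: (sub_eq_mon (Ax _ (Ay _ Ad))) => i; rewrite permM.
- exact: M11A.
have Aw r : A (mon (fun i => \prod_(l <- r) d (wperm (sylls l) i)) 1).
  apply: (@diag_grp_prod _ r xpredT (fun l i => d (wperm (sylls l) i))) => l _.
  exact: M11A (wperm_M11 _) Ad.
have Ap := Aw tperm01_plus; have Am := Aw tperm01_minus.
apply: (sub_eq_mon (diag_grpM Ap (diag_grpV Am))) => i. 
by rewrite tperm01_prod mulfK // (diag_grp_neq0 i Am).
Qed.

(** The last clause is the upper bound in its usable form: dividing [d] by one of its entries leaves
    m-th roots of unity. *)
Definition sandwiched (m : nat) : Prop :=
  [/\ (0 < m)%N,
      forall d, (forall i, d i ^+ m = 1) -> \prod_i d i = 1 -> A (mon d 1) &
      forall d, A (mon d 1) -> forall i j, d i ^+ m = d j ^+ m].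

Definition pair_entries (i j : 'I_11) (x : C) (k : 'I_11) : C :=
  if k == i then x else if k == j then x^-1 else 1.

(** The [x] for which diag(x, 1/x, 1, ..., 1) lies in A form a finite group, so all m-th roots of
    unity for some [m]. Lower bound: a diagonal of determinant 1 is a product of such pairs based at
    point 0. Upper bound: dividing the image of [d] under the transposition of [i] and [j] by [d]
    gives such a pair with entry [d i / d j]. *)
Lemma Sym_invariant_sandwiched : Sym_invariant A -> exists m, sandwiched m.
Proof.
move/Sym_invariantP => symA.
pose E x := A (mon (pair_entries (o 0) (o 1) x) 1).
have o01 : o 0 != o 1 by apply/eqP => /(congr1 val); rewrite !val_o.
have EP i j x : i != j -> E x <-> A (mon (pair_entries i j x) 1).
  move=> ij.
  have [t [ti tj]] : exists t : 'S_11, t i = o 0 /\ t j = o 1.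
    exists (tperm i (o 0) * tperm (tperm i (o 0) j) (o 1))%g.
    have j0 : tperm i (o 0) j != o 0.
      by rewrite -[X in _ != X](tpermL i (o 0)) (inj_eq perm_inj) eq_sym.
    have o10 : o 1 != o 0 by rewrite eq_sym.
    by rewrite !permM tpermL [tperm _ _ (tperm _ _ _)]tpermL (tpermD j0 o10).
  have pt k : pair_entries (o 0) (o 1) x (t k) = pair_entries i j x k.
    by rewrite /pair_entries -ti -tj !(inj_eq perm_inj).
  split=> [/(symA t)|/(symA (t^-1)%g)] At; apply: (sub_eq_mon At) => k //.
  by rewrite -pt permKV.
have [N N0 AN] := diag_grp_exponent.
have [m m0 Em] : exists2 m, (0 < m)%N & forall x, E x <-> x ^+ m = 1.
  apply: (@finite_roots_of_unity C E N N0) => //.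
  - apply: (sub_eq_mon diag_grp1) => k. 
    by rewrite /pair_entries invr1 !if_same.
  - move=> x y Ex Ey; apply: (sub_eq_mon (diag_grpM Ex Ey)) => k. 
    rewrite /pair_entries; case: eqP => // _; case: eqP => // _; rewrite ?mulr1 //.
    by rewrite invfM.
  - by move=> x /AN /(_ (o 0)); rewrite /pair_entries eqxx.
exists m; split=> // d; last first.
  move=> Ad i j; have [->//|ij] := eqVneq i j.
  have di0 := diag_grp_neq0 i Ad; have dj0 := diag_grp_neq0 j Ad.
  have : E (d i / d j).
    apply/(EP j i); first by rewrite eq_sym.
    apply: (sub_eq_mon (diag_grpM (symA (tperm i j) _ Ad) (diag_grpV Ad))) => k.
    rewrite /pair_entries.
    case: tpermP => [->|->|/eqP/negPf -> /eqP/negPf ->].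
    - by rewrite (negPf ij) eqxx invfM invrK mulrC.
    - by rewrite eqxx.
    - by rewrite divff // (diag_grp_neq0 k Ad).
  by move/Em; rewrite expr_div_n => /(canRL (divfK (expf_neq0 m dj0))); rewrite mul1r.
move=> dm prod1.
have d0 i : d i != 0.
  by have := dm i; apply: contra_eq_neq => ->; rewrite expr0n gtn_eqF // eq_sym oner_neq0.
have := @diag_grp_prod _ (index_enum 'I_11) (fun i => i != ord0)
  (fun i => pair_entries i ord0 (d i)).
have P i : i != ord0 -> A (mon (pair_entries i ord0 (d i)) 1).
  by move=> i0; apply/(EP i ord0) => //; apply/Em.
move/(_ P) => AP; apply: (sub_eq_mon AP) => k.
have [->|k0] := eqVneq k ord0.
  rewrite (eq_bigr (fun i => (d i)^-1)) => [|i i0]; last first.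
    by rewrite /pair_entries eq_sym (negPf i0) eqxx.
  have p0 : \prod_(i | i != ord0) d i != 0 by apply/prodf_neq0.
  rewrite prodfV; apply: (mulIf p0); rewrite mulVf //.
  by rewrite (bigD1 ord0) in prod1.
rewrite (bigD1 k) //= big1 ?mulr1; first by rewrite /pair_entries eqxx.
by move=> i /andP [_ ik]; rewrite /pair_entries eq_sym (negPf ik) (negPf k0).
Qed.

End DiagonalGroups.

(** * The groups generated by s, w2 diag(...) and a diagonal group *)

Lemma finite_mon_unity (F : closedFieldType) (N : nat) : (0 < N)%N ->
  finite_set [set M : 'M[F]_11 |
    exists (d : 'I_11 -> F) a, (forall i, d i ^+ N = 1) /\ M = mon d a].
Proof.
move=> N0.
have [r rE] := closed_field_poly_normal ('X^N - 1 : {poly F}).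
have rN x : x ^+ N = 1 -> x \in r.
  move=> xN; have : root ('X^N - 1) x by rewrite rootE !hornerE xN subrr.
  by rewrite rE rootZ ?root_prod_XsubC // lead_coefXnsubC //; exact: oner_neq0.
pose f (u : {ffun 'I_11 -> seq_sub r} * 'S_11) : 'M[F]_11 :=
  mon (fun i => ssval (u.1 i)) u.2.
apply: (sub_finite_set (B := [set` [seq f u | u <- enum predT]])); last first.
  exact: finite_seq.
move=> _ [d [a [dN ->]]] /=; apply/mapP.
exists ([ffun i => SeqSub (rN _ (dN i))], a); first by rewrite mem_enum.
by apply: eq_mon => i; rewrite /= ffunE.
Qed.

Lemma M11_wordP p : p \in M11 -> exists v, p = wperm v.
Proof.
pose W := [set p : 'S_11 | `[< exists v, p = wperm v >]]%SET.
have memW x : x \in W <-> exists v, x = wperm v.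
  by rewrite /W finset.in_set; split=> /asboolP.
have gW : group_set W.
  apply/group_setP; split; first by apply/memW; exists [::].
  move=> x y /memW [u ->] /memW [v ->].
  by apply/memW; exists (u ++ v); rewrite /wperm pwordM.
suff /fintype.subsetP sub : M11 \subset Group gW by move=> /sub /memW.
rewrite gen_subG; apply/fintype.subsetP => x; rewrite in_set2 => /orP [] /eqP ->.
  by apply/memW; exists [:: false]; rewrite /wperm /= mulg1.
by apply/memW; exists [:: true]; rewrite /wperm /= mulg1.
Qed.

Section WordGroup.

Variable R : realType.
Notation C := R[i].

(** Row entries of [w2_mx *m d_mx n] for [z = eps n]: the entry of [d_mx] is read at the image of
    [i] under [w2], whence the order of the list. The fixed points 8, 9, 10 take the default 1. At
    [z = 1] this is [w2_mx], at [z = -1] the signs are those of [w2_sign]. *)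
Definition w2_coef (z : C) (i : nat) : C :=
  nth 1 [:: z^-1; z; z; 1; z; z^-1; 1; z^-1] i.

Definition ones : nat -> C := fun=> 1.

Lemma s_mxE z : s_mx R = letter_mx ones (w2_coef z) false.
Proof. by rewrite /s_mx perm_mx_mon. Qed.

Lemma w2_mx_diag n :
  w2_mx R *m d_mx R n = letter_mx ones (w2_coef (eps R n)) true.
Proof.
rewrite /w2_mx perm_mx_mon /d_mx.
set D := diag_mx _.
have -> : D = mon (fun i => nth 1 [:: eps R n; (eps R n)^-1; (eps R n)^-1; 1;
     (eps R n)^-1; eps R n; 1; eps R n; 1; 1; 1] i) 1.
  apply/matrixP => i j; rewrite monE perm1 !mxE.
  by case: eqP => _; rewrite ?mulr1n ?mulr0n.
rewrite mon_mul mulg1; apply: eq_mon => i; rewrite mul1r w2_permE /w2_coef.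
by case: i => -[|[|[|[|[|[|[|[|[|[|[|k]]]]]]]]]]].
Qed.

Lemma w2_mxE : w2_mx R = letter_mx ones (w2_coef 1) true.
Proof.
rewrite /w2_mx perm_mx_mon; apply: eq_mon => i; rewrite /w2_coef invr1.
by case: i => -[|[|[|[|[|[|[|[|[|[|[|k]]]]]]]]]]].
Qed.

Variables (A : set 'M[C]_11) (m : nat) (z e : C).
Hypotheses (dA : diag_grp A) (finA : finite_set A) (symA : Sym_invariant A).
Hypotheses (mA : sandwiched A m) (z0 : z != 0) (zm : z ^+ m = e) (ee : e * e = 1).

Let Qw v : 'M[C]_11 := word_mx ones (w2_coef z) v.
Let Qc v i : C := weight ones (w2_coef z) v i.

Definition word_grp : set 'M[C]_11 :=
  [set x | exists v a, A a /\ x = word_mx ones (w2_coef z) v *m a].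

Let m0 : (0 < m)%N. Proof. by case: mA. Qed.

Let e0 : e != 0.
Proof. by apply/eqP => e0; move: ee; rewrite e0 mul0r => /eqP; rewrite eq_sym oner_eq0. Qed.

Let eV : e^-1 = e. Proof. by apply: (mulfI e0); rewrite ee divff. Qed.

Lemma w2_coef_neq0 k : (k < 11)%N -> w2_coef z k != 0.
Proof.
rewrite /w2_coef.
by case: k => [|[|[|[|[|[|[|[|[|[|[|k]]]]]]]]]]] // _;
  rewrite ?invr_neq0 ?oner_neq0.
Qed.

Lemma w2_coef_exp k : (k < 11)%N -> w2_coef z k ^+ m = 1 * (if w2_sign k then e else 1).
Proof.
rewrite /w2_coef /w2_sign mul1r.
by case: k => [|[|[|[|[|[|[|[|[|[|[|k]]]]]]]]]]] // _; rewrite /= ?exprVn ?zm ?eV ?expr1n.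
Qed.

Let Qc0 v (i : 'I_11) : Qc v i != 0.
Proof.
by apply: weight_neq0; [move=> *; exact: oner_neq0|exact: w2_coef_neq0|].
Qed.

Lemma word_mx_exp v (i : 'I_11) : Qc v i ^+ m = if word_sign v i then e else 1.
Proof.
rewrite (weight_exp v ee (cy := 1) (cx := 1)) ?expr1n ?mul1r //.
- by move=> *; rewrite expr1n.
- exact: w2_coef_exp.
Qed.

Lemma word_mx_unit v : Qw v \in unitmx.
Proof. by rewrite /Qw word_mxE mon_unit. Qed.

Lemma odd_s_perm : odd_perm s_perm = false.
Proof.
have -> : s_perm = (s_perm ^+ 6 * s_perm ^+ 6)%g.
  by rewrite -expgD (expgD _ 11 1) s_perm11 mul1g.
by rewrite odd_permM addbb.
Qed.

Lemma odd_w2_perm : odd_perm w2_perm = false.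
Proof.
have ne a b : (a < 11)%N -> (b < 11)%N -> (o a != o b) = (a != b).
  by move=> lta ltb; rewrite -(inj_eq val_inj) !val_o.
by rewrite /w2_perm !odd_permM !odd_tperm !ne.
Qed.

Lemma det_word_mx v : \det (Qw v) = 1.
Proof.
rewrite /Qw; elim: v => [|b v IH] /=; first by rewrite det1.
rewrite det_mulmx IH mulr1 det_mon; case: b.
  rewrite odd_w2_perm mul1r !big_ord_recl big_ord0 /w2_coef /=.
  by rewrite /bump /= ?nth_nil; field.
by rewrite odd_s_perm mul1r big1.
Qed.

Lemma word_mxV v : exists u, Qw v *m Qw u = 1%:M.
Proof.
rewrite /Qw; elim: v => [|b v [u IH]]; first by exists [::]; rewrite mulmx1.
exists (u ++ (if b then [:: true] else nseq 10 false)).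
rewrite word_mx_cat /= -mulmxA [word_mx _ _ v *m _]mulmxA IH mul1mx.
case: b.
  rewrite /= mulmx1 mon_mul w2_perm2 -mon1; apply: eq_mon => i.
  rewrite w2_permE /w2_coef.
  by case: i => -[|[|[|[|[|[|[|[|[|[|[|k]]]]]]]]]]] //= _;
    rewrite ?mulr1 ?mulVf ?divff.
rewrite (_ : letter_mx _ _ _ *m _ = word_mx ones (w2_coef z) (nseq 11 false)) //.
rewrite word_mxE (@wperm_eq (nseq 11 false) [::]) // -mon1; apply: eq_mon => i.
by rewrite /= !mul1r.
Qed.

Lemma diag_grp_conj_mon p d a : (forall i, d i != 0) -> A a ->
  A (mon d p *m a *m invmx (mon d p)).
Proof.
move=> d0 Aa; rewrite (diag_grp_mon dA Aa) invmx_mon // !mon_mul mulg1 mulgV.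
have Aa' : A (mon (fun i => a i i) 1) by rewrite -(diag_grp_mon dA Aa).
have Ap := iffLR (Sym_invariantP dA) symA p _ Aa'.
apply: (sub_eq_mon Ap) => i.
by rewrite /= permK mulrAC divff ?mul1r.
Qed.

Lemma word_grp_is_grp : is_grp word_grp.
Proof.
have [[A1 uA mulA invA] _] := dA.
have conjA v a : A a -> exists2 b, A b & a *m Qw v = Qw v *m b.
  move=> Aa; exists (invmx (Qw v) *m a *m Qw v); last first.
    by rewrite !mulmxA mulmxV ?word_mx_unit // mul1mx.
  rewrite {1}/Qw word_mxE invmx_mon //.
  have -> : Qw v = invmx (mon (fun i => (Qc v ((wperm v)^-1%g i))^-1) ((wperm v)^-1)%g).
    rewrite invmx_mon => [|i]; last by rewrite invr_neq0.
    by rewrite /Qw word_mxE invgK; apply: eq_mon => i; rewrite permK invrK.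
  by apply: diag_grp_conj_mon => // i; rewrite invr_neq0.
split.
- by exists [::], 1%:M; split=> //; rewrite mulmx1.
- by move=> x [v [a [Aa ->]]]; rewrite unitmx_mul word_mx_unit uA.
- move=> x y [u [a [Aa ->]]] [v [b [Ab ->]]].
  have [c Ac ac] := conjA v a Aa.
  exists (u ++ v), (c *m b); split; first exact: mulA.
  by rewrite word_mx_cat -!mulmxA; congr (_ *m _); rewrite !mulmxA -/(Qw v) ac.
- move=> x [v [a [Aa ->]]]; have [u uv] := word_mxV v.
  have [c Ac ac] := conjA u _ (invA _ Aa).
  exists u, c; split=> //; rewrite -/(Qw u) -ac.
  have xu : Qw v *m a \in unitmx by rewrite unitmx_mul word_mx_unit uA.
  apply: (can_inj (mulKmx xu)); rewrite mulmxV //.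
  by rewrite -mulmxA [a *m _]mulmxA mulmxV ?uA // mul1mx.
Qed.

Lemma gen_word_grp :
  gen ([set letter_mx ones (w2_coef z) false; letter_mx ones (w2_coef z) true] `|` A)
  = word_grp.
Proof.
have [[A1 uA mulA invA] _] := dA.
rewrite eqEsubset; split=> x.
  apply; first exact: word_grp_is_grp.
  move=> y [[->|->]|Ay].
  - by exists [:: false], 1%:M; rewrite /= !mulmx1.
  - by exists [:: true], 1%:M; rewrite /= !mulmx1.
  - by exists [::], y; rewrite /= mul1mx.
case=> v [a [Aa ->]] G gG SG; have [G1 _ mulG _] := gG.
apply: (mulG); last by apply: SG; right.
elim: v => [//|b v IH] /=; apply: (mulG) => //.
by apply: SG; left; case: b; [right|left].
Qed.

Lemma word_grp_mon x : word_grp x -> exists v (c : 'I_11 -> C),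
  [/\ A (mon c 1), x = mon (fun i => Qc v i * c (wperm v i)) (wperm v) &
      x = Qw v *m mon c 1].
Proof.
case=> v [a [Aa ->]]; exists v, (fun i => a i i); rewrite -(diag_grp_mon dA Aa).
by split=> //; rewrite word_mxE {1}(diag_grp_mon dA Aa) mon_mul mulg1.
Qed.

Lemma word_grp_entry_neq0 v (c : 'I_11 -> C) (i : 'I_11) : A (mon c 1) ->
  Qc v i * c (wperm v i) != 0 :> C.
Proof. by move=> Ac; rewrite mulf_neq0 ?(diag_grp_neq0 dA _ Ac). Qed.

Lemma sub_word_grp x : A x -> word_grp x.
Proof. by move=> Ax; exists [::], x; rewrite /= mul1mx. Qed.

(** A word with trivial permutation has determinant 1, and by [word_sign_id] its entries have m-th
    power 1 even if [e = -1]; the lower bound of the sandwich puts it in A. *)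
Lemma word_grp_diag x : word_grp x -> is_diag_mx x -> A x.
Proof.
move=> /word_grp_mon [v [c [Ac xE xQ]]] dx.
have v1 : wperm v = 1%g.
  apply: (@mon_is_diag _ (fun i => Qc v i * c (wperm v i))); last by rewrite -xE.
  by move=> i; apply: word_grp_entry_neq0.
have vid i : (i < 11)%N -> word_nat v i = i.
  by move=> lti; rewrite -(val_o lti) -wpermE v1 perm1.
rewrite xQ; have [[_ _ mulA _] _] := dA; apply: mulA => //.
have [_ mA' _] := mA; rewrite /Qw word_mxE v1; apply: mA' => [i|].
  by rewrite word_mx_exp word_sign_id.
by have := det_word_mx v; rewrite /Qw word_mxE v1 det_mon perm.odd_perm1 mul1r.
Qed.

Lemma word_grp_perm_part : perm_part word_grp = M11.
Proof.
apply/setP => p; rewrite finset.in_set; apply/asboolP/idP => [[d [d0]]|].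
  move=> /word_grp_mon [v [c [_ E _]]].
  by have [-> _] := mon_inj d0 (etrans (esym (diag_perm_mon d p)) E); exact: wperm_M11.
move=> /M11_wordP [v ->]; exists (\row_i Qc v i); split=> [i|].
  by rewrite mxE.
exists v, 1%:M; rewrite mulmx1 word_mxE; split; first by case: dA => -[].
by rewrite diag_perm_mon; apply: eq_mon => i; rewrite mxE.
Qed.

Lemma word_grp_monomial : word_grp `<=` @monomial R.
Proof.
move=> x /word_grp_mon [v [c [Ac -> _]]].
exists (wperm v), (\row_i (Qc v i * c (wperm v i))); split=> // i.
by rewrite mxE word_grp_entry_neq0.
Qed.

Lemma word_grp_finite : finite_set word_grp.
Proof.
have [N N0 AN] := diag_grp_exponent dA finA.
have M0 : (0 < m * 2 * N)%N by rewrite !muln_gt0 m0 N0.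
apply: sub_finite_set (finite_mon_unity C M0) => x /word_grp_mon [v [c [Ac -> _]]].
exists (fun i : 'I_11 => Qc v i * c (wperm v i)), (wperm v); split=> // i.
rewrite exprMn [X in _ * X](_ : _ = 1); last by rewrite mulnC exprM AN // expr1n.
rewrite mulr1 !exprM word_mx_exp.
by case: ifP; rewrite ?expr1n // expr2 ee expr1n.
Qed.

(** A nonzero vector of an invariant subspace has a nonzero coordinate, which a power of [s] moves
    to point 0. The matrix unit then isolates the basis vector there, and the powers of [s] produce
    all the others. *)
Lemma irreducible_of_e00 (G : set 'M[C]_11) : G (s_mx R) ->
  (forall U : 'M[C]_11, (forall g, G g -> (U *m g <= U)%MS) ->
     (U *m delta_mx 0 0 <= U)%MS) ->
  irreducible_grp G.
Proof.
move=> Gs GU U invU; have [->|Un0] := eqVneq U 0; [by left|right].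
have sU k : (U *m perm_mx (s_perm ^+ k)%g <= U)%MS.
  elim: k => [|k IH]; first by rewrite expg0 perm_mx1 mulmx1.
  rewrite expgSr perm_mxM mulmxA; apply: submx_trans (submxMr _ IH) _.
  exact: invU.
have [i [j Uij]] : exists i j, U i j != 0.
  have /matrix0Pn [i [j Uij]] := Un0; by exists i, j.
have e0U : ((delta_mx 0 0 : 'rV[C]_11) <= U)%MS.
  pose p := (s_perm ^+ (11 - j))%g.
  have pj : p j = 0.
    by apply: val_inj; rewrite /= s_permX subnKC ?modnn // ltnW.
  have : (row i (U *m perm_mx p *m (delta_mx 0 0 : 'M_11)) <= U)%MS.
    rewrite (submx_trans (row_sub _ _)) //.
    exact: submx_trans (submxMr _ (sU _)) (GU _ invU).
  have -> : row i (U *m perm_mx p *m (delta_mx 0 0 : 'M_11)) = U i j *: delta_mx 0 0.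
    apply/rowP => k; rewrite mxE [LHS]mxE (bigD1 0) //= big1 => [|l l0]; last first.
      by rewrite !mxE (negPf l0) mulr0.
    rewrite !mxE [in LHS](bigD1 j) //= big1 => [|l lj]; last first.
      by rewrite !mxE -pj (inj_eq perm_inj) (negPf lj) mulr0.
    by rewrite !mxE pj !eqxx /= mulr1 !addr0.
  by move/(scalemx_sub (U i j)^-1); rewrite scalerA mulVf // scale1r.
rewrite -sub1mx; apply/row_subP => k; rewrite rowE mulmx1.
have -> : delta_mx 0 k = (delta_mx 0 0 : 'rV[C]_11) *m perm_mx (s_perm ^+ k)%g.
  rewrite -rowE; apply/rowP => l; rewrite !mxE eqxx /=.
  congr (_ %:R); congr (nat_of_bool _); rewrite eq_sym; congr (_ == _).
  by apply: val_inj; rewrite /= s_permX add0n modn_small.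
exact: submx_trans (submxMr _ e0U) (sU _).
Qed.

Lemma prod_pair_entries (i j : 'I_11) (x : C) : i != j -> x != 0 ->
  \prod_k pair_entries i j x k = 1.
Proof.
move=> ij x0; rewrite (bigD1 i) //= (bigD1 j) 1?eq_sym //= big1 => [|k /andP [ki kj]].
  by rewrite /pair_entries !eqxx eq_sym (negPf ij) mulr1 divff.
by rewrite /pair_entries (negPf ki) (negPf kj).
Qed.

Lemma pair_entries_mem (i j : 'I_11) (x : C) : i != j -> x ^+ m = 1 ->
  A (mon (pair_entries i j x) 1).
Proof.
move=> ij xm; have [_ mA' _] := mA.
have x0 : x != 0.
  by apply: contra_eq_neq xm => ->; rewrite expr0n gtn_eqF // eq_sym oner_neq0.
apply: mA' => [k|]; last exact: prod_pair_entries.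
by rewrite /pair_entries; do 2?[case: ifP => _]; rewrite ?expr1n // exprVn xm invr1.
Qed.

Lemma sum_signs (I : Type) (r : seq I) (p q : pred I) :
  \sum_(l <- r) (if p l then if q l then -1 else 1 else 0) =
  (count (fun l => p l && ~~ q l) r)%:R - (count (fun l => p l && q l) r)%:R :> C.
Proof.
elim: r => [|l r IH]; first by rewrite big_nil subrr.
rewrite big_cons IH /= !natrD.
by case: (p l); case: (q l) => /=; ring.
Qed.

Lemma e00_words_sum : z = -1 ->
  \sum_(l <- e00_words) Qw (sylls l) = 18%:R *: delta_mx 0 0.
Proof.
move=> z1; apply/matrixP => i j; rewrite summxE !mxE.
have Qij l : Qw (sylls l) i j =
    if word_nat (sylls l) i == j then if word_sign (sylls l) i then -1 else 1 else 0.
  rewrite /Qw word_mxE monE -wpermE.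
  have -> : weight ones (w2_coef z) (sylls l) i = if word_sign (sylls l) i then -1 else 1.
    rewrite -[LHS]expr1 (weight_exp _ (z := -1) (cy := 1) (cx := 1)) ?expr1n ?mul1r //.
    - by rewrite mulrNN mulr1.
    - rewrite z1 => k ltk; rewrite expr1 mul1r /w2_coef /w2_sign invrN invr1.
      by case: k ltk => [|[|[|[|[|[|[|[|[|[|[|k]]]]]]]]]]].
  by rewrite (inj_eq val_inj).
rewrite (eq_bigr _ (fun l _ => Qij l)) sum_signs.
have iI : (i : nat) \in iota 0 11 by rewrite mem_iota /= ltn_ord.
have jI : (j : nat) \in iota 0 11 by rewrite mem_iota /= ltn_ord.
have /eqP -> := allP (allP e00_wordsP _ iI) _ jI.
rewrite natrD addrK -!val_eqE /=.
by case: (_ && _); rewrite ?mulr1 ?mulr0.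
Qed.

(** Two ways to obtain the matrix unit at point 0: from A if there is a nontrivial m-th root of
    unity, and from signed words if [z = -1]. The second covers in particular [m = 1], where A is
    scalar and cannot separate coordinates. *)
Lemma word_grp_irreducible :
  (exists2 x : C, x != 1 & x ^+ m = 1) \/ z = -1 -> irreducible_grp word_grp.
Proof.
move=> xz; apply: irreducible_of_e00.
  rewrite (s_mxE z); exists [:: false], 1%:M; rewrite /= !mulmx1.
  by split=> //; case: dA => -[].
move=> U invU; case: xz => [[x x1 xm]|z1]; last first.
  have : (U *m \sum_(l <- e00_words) Qw (sylls l) <= U)%MS.
    rewrite mulmx_sumr; apply: summx_sub => l _; apply: invU.
    by exists (sylls l), 1%:M; rewrite mulmx1; split=> //; case: dA => -[].
  rewrite (e00_words_sum z1) -scalemxAr => /(scalemx_sub 18%:R^-1).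
  by rewrite scalerA mulVf ?scale1r // pnatr_eq0.
have ne a b : (a < 11)%N -> (b < 11)%N -> (o a != o b) = (a != b).
  by move=> lta ltb; rewrite -(inj_eq val_inj) !val_o.
pose g k := mon (pair_entries (o 0) (o k) x) 1.
have gU k : (0 < k < 11)%N -> (U *m (g k - 1%:M) <= U)%MS.
  move=> /andP [k0 k11]; rewrite mulmxBr mulmx1 addmx_sub ?eqmx_opp // invU //.
  by apply/sub_word_grp/pair_entries_mem; rewrite // ne // eq_sym -lt0n.
have : (U *m (g 1%N - 1%:M) *m (g 2%N - 1%:M) <= U)%MS.
  exact: submx_trans (submxMr _ (gU 1%N isT)) (gU 2%N isT).
(* The two factors are supported on the points 0, 1 and 0, 2, so only point 0 survives in their
   product. *)
have -> : U *m (g 1%N - 1%:M) *m (g 2%N - 1%:M) = (x - 1) ^+ 2 *: (U *m delta_mx 0 0).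
  rewrite -mulmxA scalemxAr; congr (_ *m _).
  rewrite !mon_sub1 mon_mul mulg1 -mon_e00; apply: eq_mon => i; rewrite perm1.
  have o00 : o 0 = 0 by apply: val_inj; rewrite val_o.
  rewrite /pair_entries -o00; case: (eqVneq i (o 0)) => [//|_].
  case: (eqVneq i (o 1)) => [->|_]; last by rewrite subrr mul0r.
  by rewrite (negPf (_ : o 1 != o 2)) ?ne // subrr mulr0.
move/(scalemx_sub ((x - 1) ^+ 2)^-1); rewrite scalerA mulVf ?scale1r //.
by rewrite expf_eq0 /= subr_eq0.
Qed.

Lemma word_grp_good :
  (exists2 x : C, x != 1 & x ^+ m = 1) \/ z = -1 -> good_grp word_grp.
Proof.
move=> xz; split; [exact: word_grp_is_grp|exact: word_grp_finite|
  exact: word_grp_monomial|exact: word_grp_irreducible|].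
by rewrite word_grp_perm_part isog_refl.
Qed.

(* Invariant under conjugation by monomial matrices, the quotients
   [x i i ^+ 11 / \det x] separate the two families. *)
Lemma word_grp_diag_entry x i : e = 1 -> word_grp x -> x i i != 0 ->
  (x i i ^+ 11 / \det x) ^+ m = 1.
Proof.
move=> e1 /word_grp_mon [v [c [Ac xE xQ]]] xi.
have [_ _ Am] := mA.
have cm j : c j ^+ m = c i ^+ m by exact: Am.
have xm : x i i ^+ m = c i ^+ m.
  move: xi; rewrite xE monE; case: (wperm v i =P i) => [-> _|_]; last by rewrite eqxx.
  by rewrite exprMn word_mx_exp e1 if_same mul1r.
have ci0 := diag_grp_neq0 dA i Ac.
rewrite expr_div_n exprAC xm.
have -> : \det x ^+ m = (c i ^+ m) ^+ 11.
  rewrite xQ det_mulmx det_word_mx mul1r det_mon perm.odd_perm1 mul1r -prodrXl.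
  by rewrite (eq_bigr (fun=> c i ^+ m)) // prodr_const card_ord.
by rewrite divff // !expf_neq0.
Qed.

Lemma word_grp_diag_entry_neq : e = -1 ->
  exists2 x, word_grp x & x (o 0) (o 0) != 0 /\
    (x (o 0) (o 0) ^+ 11 / \det x) ^+ m != 1.
Proof.
(* The word [w2 s^9] sends 0 to 2 and back to 0, with entry [z^-1] and determinant 1; the m-th power
   of [z^-11] is then -1. *)
move=> e1; pose v := true :: nseq 9 false.
have xE : Qw v (o 0) (o 0) = z^-1.
  have v0 : wperm v (o 0) = o 0.
    by apply: val_inj; rewrite val_o // [LHS]wpermE val_o.
  by rewrite /Qw word_mxE monE v0 eqxx (val_o (isT : (0 < 11)%N)) /= !mul1r mulr1.
exists (Qw v).
  by exists v, 1%:M; rewrite mulmx1; split=> //; case: dA => -[].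
rewrite xE invr_neq0 //; split=> //.
rewrite det_word_mx divr1 exprAC exprVn zm e1 invrN invr1.
by rewrite exprS -signr_odd /= expr0 mulr1 eq_sym -addr_eq0 (_ : 1 + 1 = 2%:R) // pnatr_eq0.
Qed.

End WordGroup.

(** * Parameters of a group of either family, and its diagonal part *)

Section Classification.

Variable R : realType.
Notation C := R[i].
Implicit Types (A B G H K : set 'M[C]_11) (d : 'I_11 -> C).

Lemma mon_expn d k : (mon d 1 : 'M[C]_11) ^+ k = mon (fun i => d i ^+ k) 1.
Proof.
elim: k => [|k IH]; first by rewrite expr0 -[LHS]/(1%:M) -mon1.
rewrite exprS IH -mulmxE mon_mul mulg1; apply: eq_mon => i.
by rewrite perm1 exprS.
Qed.

Lemma OmegaX2_mon n d :
  OmegaX2 n (mon d 1) <-> (forall i, d i ^+ (2 ^ n) = 1) /\ \prod_i d i = 1.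
Proof.
have detE : \det (mon d 1) = \prod_i d i by rewrite det_mon perm.odd_perm1 mul1r.
have expE k : mon d 1 ^+ (2 ^ k) = 1%:M <-> forall i, d i ^+ (2 ^ k) = 1.
  rewrite mon_expn -mon1; split=> [E i|dk]; last exact: eq_mon.
  by have /(congr1 (fun M : 'M[C]_11 => M i i)) := E; rewrite !monE perm1 eqxx.
split=> [[[[_ _ det1] _] /expE dk]|[dk d1]]; first by rewrite -detE.
split; last exact/expE.
split; last by exists n; apply/expE.
split; rewrite ?detE ?is_diag_mon //.
apply: mon_unit => i; apply: contra_eq_neq (dk i) => ->.
by rewrite expr0n expn_eq0 /= eq_sym oner_neq0.
Qed.

Lemma eps_exp n : eps R n.+1 ^+ (2 ^ n) = -1.
Proof. by rewrite /eps /= rootCK // expn_gt0. Qed.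

Lemma eps_neq0 n : eps R n.+1 != 0.
Proof.
apply: contra_eq_neq (eps_exp n) => ->.
by rewrite expr0n expn_eq0 /= eq_sym oppr_eq0 oner_neq0.
Qed.

Lemma eps_exp2 n : eps R n.+1 ^+ (2 ^ n.+1) = 1.
Proof. by rewrite expnS mulnC exprM eps_exp sqrrN expr1n. Qed.

Lemma neq1N1 : (-1 : C) != 1.
Proof. by rewrite eq_sym -addr_eq0 (_ : 1 + 1 = 2%:R) // pnatr_eq0. Qed.

Let o_neq a b : (a < 11)%N -> (b < 11)%N -> (o a != o b) = (a != b).
Proof. by move=> lta ltb; rewrite -(inj_eq val_inj) !val_o. Qed.

Lemma OmegaX2_pair n (x : C) : x ^+ (2 ^ n) = 1 ->
  OmegaX2 n (mon (pair_entries (o 0) (o 1) x) 1).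
Proof.
move=> xn.
have x0 : x != 0.
  by apply: contra_eq_neq xn => ->; rewrite expr0n expn_eq0 /= eq_sym oner_neq0.
apply/OmegaX2_mon; split; last by apply: prod_pair_entries; rewrite ?o_neq.
by move=> i; rewrite /pair_entries; do 2?[case: ifP => _]; rewrite ?expr1n // exprVn xn invr1.
Qed.

(** Put [x = eps (n + 1)], of order [2 ^ (n + 1)]. The pair with entry [x ^+ 2] lies in A, so
    [x ^+ m] is 1 or -1. Were it 1, the pair with entry [x] would lie in A and hence in [OmegaX2 n],
    against [x ^+ (2 ^ n) = -1]. *)
Lemma sandwiched_eps_exp A m n : diag_grp A -> sandwiched A m ->
  A `&` @X2 R = OmegaX2 n -> eps R n.+1 ^+ m = -1.
Proof.
move=> dA mA AX; set x := eps R n.+1; have [_ A_in A_exp] := mA.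
have pair_exp y : A (mon (pair_entries (o 0) (o 1) y) 1) -> y ^+ m = 1.
  move/A_exp/(_ (o 0) (o 2)); rewrite /pair_entries eqxx.
  by rewrite (negPf (_ : o 2 != o 0)) ?o_neq // (negPf (_ : o 2 != o 1)) ?o_neq // expr1n.
have : (x ^+ m) ^+ 2 = 1.
  rewrite exprAC; apply: pair_exp.
  have : OmegaX2 n (mon (pair_entries (o 0) (o 1) (x ^+ 2)) 1).
    by apply: OmegaX2_pair; rewrite -exprM -expnS eps_exp2.
  by rewrite -AX => -[].
move/eqP; rewrite sqrf_eq1 => /orP [] /eqP // xm.
suff : OmegaX2 n (mon (pair_entries (o 0) (o 1) x) 1).
  move/OmegaX2_mon => [/(_ (o 0)) + _]; rewrite /pair_entries eqxx eps_exp => /eqP.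
  by rewrite (negPf neq1N1).
rewrite -AX; split; last first.
  by have [] := OmegaX2_pair (eps_exp2 n).
apply: (pair_entries_mem mA) => //; exact: o_neq.
Qed.

Lemma not_scalar_neq A : diag_grp A -> ~ (forall a, A a -> is_scalar_mx a) ->
  exists d, A (mon d 1) /\ exists i j, d i != d j.
Proof.
move=> dA nsc; apply: contrapT => nex; apply: nsc => a Aa.
have Aa' : A (mon (fun i => a i i) 1) by rewrite -(diag_grp_mon dA Aa).
apply/is_scalar_mxP; exists (a 0 0); rewrite {1}(diag_grp_mon dA Aa).
apply/matrixP => i j; rewrite monE perm1 [RHS]mxE.
case: eqP => [_|_]; last by rewrite mulr0n.
rewrite mulr1n; apply/eqP; apply: contrapT => /negP ne; apply: nex.
by exists (fun i => a i i); split=> //; exists i, 0.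
Qed.

Lemma eps_nontrivial_root A m n : diag_grp A -> sandwiched A m ->
  A `&` @X2 R = OmegaX2 n ->
  (exists2 x : C, x != 1 & x ^+ m = 1) \/ eps R n.+1 = -1.
Proof.
move=> dA mA AX; case: n AX => [|n] AX; first by right; have := eps_exp 0; rewrite expr1.
left; exists (eps R n.+2 ^+ 2); last first.
  by rewrite exprAC (sandwiched_eps_exp dA mA AX) sqrrN expr1n.
apply: contra_eq_neq (eps_exp n.+1) => e2.
by rewrite expnS exprM e2 expr1n eq_sym neq1N1.
Qed.

Lemma not_scalar_nontrivial_root A m : diag_grp A -> sandwiched A m ->
  ~ (forall a, A a -> is_scalar_mx a) -> exists2 x : C, x != 1 & x ^+ m = 1.
Proof.
move=> dA [_ _ A_exp] /(not_scalar_neq dA) [d [Ad [i [j dij]]]].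
have dj0 := diag_grp_neq0 dA j Ad.
exists (d i / d j); last by rewrite expr_div_n (A_exp _ Ad i j) divff // expf_neq0.
apply: contra_neq dij => dij1.
by rewrite -[LHS](divfK dj0) dij1 mul1r.
Qed.

(* [b] is [true] for the family of the groups with [w2_mx *m d_mx n.+1]. *)
Definition Qstar_data (H A : set 'M[C]_11) (z : C) (b : bool) : Prop :=
  [/\ [/\ diag_grp A, finite_set A & Sym_invariant A],
      H = word_grp A z, z != 0,
      forall m, sandwiched A m -> z ^+ m = (if b then -1 else 1) /\
        ((exists2 x : C, x != 1 & x ^+ m = 1) \/ z = -1) &
      if b then exists n, z = eps R n.+1 /\ A `&` @X2 R = OmegaX2 n
      else z = 1 /\ ~ (forall a, A a -> is_scalar_mx a)].

Lemma Qstar_dataP H : Qstar H <-> exists A z b, Qstar_data H A z b.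
Proof.
split=> [[[A [dA fA sA nsc HE]]|[n [A [dA fA sA AX HE]]]]|[A [z [b HA]]]].
- exists A, 1, false; split; rewrite ?oner_neq0 //.
    rewrite HE (s_mxE 1) w2_mxE.
    exact: gen_word_grp dA sA (oner_neq0 _).
  move=> m mA; rewrite expr1n; split=> //; left.
  exact: not_scalar_nontrivial_root mA nsc.
- exists A, (eps R n.+1), true; split; rewrite ?eps_neq0 //; last by exists n.
    rewrite HE (s_mxE (eps R n.+1)) w2_mx_diag.
    exact: gen_word_grp dA sA (eps_neq0 n).
  move=> m mA; split; first exact: sandwiched_eps_exp mA AX.
  exact: eps_nontrivial_root mA AX.
case: HA => -[dA fA sA] HE z0 _; case: b => [[n [zE AX]]|[zE nsc]].
  right; exists n, A; split=> //.
  by rewrite HE zE -(gen_word_grp dA sA (eps_neq0 n)) -s_mxE -w2_mx_diag.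
left; exists A; split=> //.
by rewrite HE zE -(gen_word_grp dA sA (oner_neq0 _)) -s_mxE -w2_mxE.
Qed.

Lemma sign_sqr (b : bool) : (if b then -1 else 1) * (if b then -1 else 1) = 1 :> C.
Proof. by case: b; rewrite ?mulrNN mulr1. Qed.

Lemma Qstar_data_good H A z b : Qstar_data H A z b -> good_grp H.
Proof.
move=> [[dA fA sA] -> z0 AZ _].
have [m mA] := Sym_invariant_sandwiched dA fA sA; have [zm xz] := AZ _ mA.
exact: (word_grp_good dA fA sA mA z0 zm (sign_sqr b)).
Qed.

Lemma Qstar_data_diag H A z b x : Qstar_data H A z b ->
  A x <-> H x /\ is_diag_mx x.
Proof.
move=> [[dA fA sA] -> z0 AZ _].
have [m mA] := Sym_invariant_sandwiched dA fA sA; have [zm xz] := AZ _ mA.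
split=> [Ax|[Hx dx]].
  by split; [exact: sub_word_grp | rewrite (diag_grp_mon dA Ax) is_diag_mon].
exact: (word_grp_diag dA mA z0 zm (sign_sqr b) Hx dx).
Qed.

Lemma Qstar_data_perm H A z b : Qstar_data H A z b -> perm_part H = M11.
Proof.
move=> [[dA fA sA] -> z0 AZ _].
have [m mA] := Sym_invariant_sandwiched dA fA sA; have [zm xz] := AZ _ mA.
exact: (word_grp_perm_part dA z0).
Qed.

Lemma monomialP G x : G `<=` @monomial R -> G x ->
  exists p d, (forall i, d i != 0) /\ x = mon d p.
Proof.
move=> Gm /Gm [p [d [d0 ->]]]; exists p, (fun i => d 0 i).
split; [exact: d0 | exact: diag_perm_mon].
Qed.

Lemma mem_perm_part G d p : (forall i, d i != 0) -> G (mon d p) -> p \in perm_part G.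
Proof.
move=> d0 Gx; rewrite finset.in_set; apply/asboolP; exists (\row_i d i).
by split=> // i; rewrite mxE.
Qed.

Lemma perm_partP G p : p \in perm_part G ->
  exists d, (forall i, d i != 0) /\ G (mon d p).
Proof.
rewrite finset.in_set => /asboolP [d [d0 Gd]]; exists (fun i => d 0 i).
by rewrite -diag_perm_mon.
Qed.

Lemma conj_mx_mul (g x y : 'M[C]_11) : g \in unitmx ->
  (invmx g *m x *m g) *m (invmx g *m y *m g) = invmx g *m (x *m y) *m g.
Proof. by move=> ug; rewrite !mulmxA mulmxK. Qed.

Lemma conj_mx_inv (g x : 'M[C]_11) : g \in unitmx -> x \in unitmx ->
  invmx (invmx g *m x *m g) = invmx g *m invmx x *m g.
Proof.
move=> ug ux; have uy : invmx g *m x *m g \in unitmx.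
  by rewrite !unitmx_mul unitmx_inv ug ux.
apply: (can_inj (mulKmx uy)); rewrite mulmxV // conj_mx_mul // mulmxV //.
by rewrite mulmx1 mulVmx.
Qed.

(* The conjugate of the diagonal part is an abelian normal subgroup, whose
   permutation part is therefore trivial. *)
Lemma conj_diag_part H K A B zA zB bA bB (g : 'M[C]_11) :
  Qstar_data H A zA bA -> Qstar_data K B zB bB -> g \in unitmx ->
  K = conj_set g H -> forall x, A x -> B (invmx g *m x *m g).
Proof.
move=> HA KB ug KE.
have KH h : H h -> K (invmx g *m h *m g) by move=> Hh; rewrite KE; exists h.
have [Hgrp _ Hm _ _] := Qstar_data_good HA.
have [H1 uH mulH invH] := Hgrp.
have [_ _ Km _ _] := Qstar_data_good KB.
have Kp := Qstar_data_perm KB.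
have AH := @Qstar_data_diag _ _ _ _ ^~ HA.
have [[dA _ sA] _ _ _ _] := HA; have [[A1 uA mulA invA] _] := dA.
pose N0 := [set p : 'S_11 | `[< exists x d, [/\ A x, forall i, d i != 0 &
                             invmx g *m x *m g = mon d p] >]]%SET.
have memN p : p \in N0 <-> exists x d, [/\ A x, forall i, d i != 0 &
                             invmx g *m x *m g = mon d p].
  by rewrite /N0 finset.in_set; split=> /asboolP.
have gN : group_set N0.
  apply/group_setP; split.
    apply/memN; exists 1%:M, (fun=> 1); split=> // [i|]; first exact: oner_neq0.
    by rewrite mulmx1 mulVmx // mon1.
  move=> p q /memN [x [d [Ax d0 xE]]] /memN [y [c [Ay c0 yE]]]; apply/memN.
  exists (x *m y), (fun i => d i * c (p i)); split; first exact: mulA.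
    by move=> i; rewrite mulf_neq0.
  by rewrite -(conj_mx_mul x y ug) xE yE mon_mul.
have abN : abelian (Group gN).
  apply/centsP => p /memN [x [d [Ax d0 xE]]] q /memN [y [c [Ay c0 yE]]].
  have xy : x *m y = y *m x.
    rewrite (diag_grp_mon dA Ax) (diag_grp_mon dA Ay) !mon_mul mulg1.
    by apply: eq_mon => i; rewrite !perm1 mulrC.
  have E : mon d p *m mon c q = mon c q *m mon d p.
    have := congr1 (fun M => invmx g *m M *m g) xy.
    by rewrite -(conj_mx_mul x y ug) -(conj_mx_mul y x ug) xE yE.
  rewrite !mon_mul in E.
  by have [] := mon_inj (fun i => mulf_neq0 (d0 i) (c0 (p i))) E.
have nN t : t \in M11 -> t \in 'N(Group gN)%g.
  rewrite -Kp => /perm_partP [f [f0]]; rewrite KE => -[h Hh hE].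
  rewrite finset.inE; apply/fintype.subsetP => y /imsetP [r /memN [x [c [Ax c0 xE]]] yE].
  rewrite {y}yE.
  have uh := uH _ Hh.
  apply/memN; exists (invmx h *m x *m h).
  have E : invmx g *m (invmx h *m x *m h) *m g =
     mon (fun i => (f ((t^-1)%g i))^-1 * c ((t^-1)%g i) * f (r ((t^-1)%g i))) (r ^ t)%g.
    rewrite -(conj_mx_mul _ _ ug) -(conj_mx_mul _ _ ug) -(conj_mx_inv ug uh) hE xE.
    rewrite (invmx_mon t f0) !mon_mul.
    rewrite conjgE mulgA; apply: eq_mon => i; by rewrite !permM.
  exists (fun i => (f ((t^-1)%g i))^-1 * c ((t^-1)%g i) * f (r ((t^-1)%g i))).
  split=> //; last by move=> i; rewrite !mulf_neq0 ?invr_neq0.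
  have [q [u [u0 hm]]] := monomialP Hm Hh.
  rewrite hm -[X in _ *m X]invmxK [invmx (mon u q)]invmx_mon //.
  by apply: (diag_grp_conj_mon dA sA) => // i; rewrite invr_neq0.
have sM : s_perm \in M11 by apply: mem_gen; rewrite !inE eqxx.
have wM : w2_perm \in M11 by apply: mem_gen; rewrite !inE eqxx orbT.
have N1 := M11_abelian_normal_trivial abN (nN _ sM) (nN _ wM).
move=> x Ax; have [Hx _] := (AH x).1 Ax.
have [p [d [d0 xE]]] := monomialP Km (KH _ Hx).
apply/(Qstar_data_diag _ KB); split; first exact: KH.
have : p \in Group gN by apply/memN; exists x, d.
by rewrite N1 => /set1P p1; rewrite xE p1 is_diag_mon.
Qed.

End Classification.

(** * Distinct groups of the two families are not conjugate *)

Section NonConjugacy.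

Variable R : realType.
Notation C := R[i].
Implicit Types (A B G H K : set 'M[C]_11).

(** The columns of [g] are common eigenvectors of A. Nonzero entries at [i] and [k] in one column
    would give a pair based at [i] both eigenvalues [x] and 1, so each column has at most one
    nonzero entry. *)
Lemma separated_monomial A m (x : C) (g : 'M[C]_11) : sandwiched A m ->
  x != 1 -> x ^+ m = 1 -> g \in unitmx ->
  (forall a, A a -> exists b : 'I_11 -> C, invmx g *m a *m g = mon b 1) ->
  exists q (d : 'I_11 -> C), (forall i, d i != 0) /\ g = mon d q.
Proof.
move=> mA x1 xm ug diagA.
have col_uniq i k j : g i j != 0 -> g k j != 0 -> i = k.
  move=> gij gkj; apply/eqP; apply: contraT => ik.
  (* The inverse entry goes to a third point: at [k] it would give the eigenvalue [x^-1], which is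
     [x] itself when [x = -1]. *)
  have [l [il kl]] : exists l : 'I_11, i != l /\ k != l.
    have : (1 < #|[set~ i]%SET :\ k|)%N.
      have := cardsD1 k [set~ i]%SET; rewrite cardsC1 card_ord !finset.inE eq_sym ik add1n.
      by move=> [<-].
    case/card_gt1P => l [_ [+ _ _]]; rewrite !finset.inE => /andP [lk li].
    by exists l; rewrite eq_sym li eq_sym lk.
  have [b bE] := diagA _ (pair_entries_mem mA il xm).
  have E : mon (pair_entries i l x) 1 *m g = g *m mon b 1.
    by rewrite -bE !mulmxA (mulmxV ug) mul1mx.
  have entE r : pair_entries i l x r * g r j = g r j * b j.
    have /matrixP/(_ r j) := E.
    rewrite mxE (bigD1 r) //= big1 => [|s sr]; last first.
      by rewrite monE perm1 eq_sym (negPf sr) mul0r.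
    rewrite [X in _ = X -> _]mxE (bigD1 j) //= big1 => [|s sj]; last first.
      by rewrite monE perm1 (negPf sj) mulr0.
    by rewrite !monE !perm1 !eqxx !addr0.
  have xE : b j = x.
    by apply: (mulfI gij); rewrite -entE /pair_entries eqxx mulrC.
  have bE1 : b j = 1.
    apply: (mulfI gkj); rewrite -entE /pair_entries eq_sym (negPf ik) (negPf kl).
    by rewrite mulrC.
  by move: x1; rewrite -xE bE1 eqxx.
have row_ex i : exists j, g i j != 0.
  apply/existsP; apply: contraT; rewrite negb_exists => /forallP g0.
  have /matrixP/(_ i i) := mulmxV ug.
  rewrite mxE big1 => [|j _]; last by rewrite (eqP (negPn (g0 j))) mul0r.
  by rewrite mxE eqxx => /eqP; rewrite eq_sym oner_eq0.
have [f fP] := choice row_ex.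
have finj : injective f by move=> i k fik; apply: (col_uniq _ _ (f i)) => //; rewrite fik.
exists (perm finj), (fun i => g i (f i)); split=> //.
apply/matrixP => i j; rewrite monE permE.
case: eqP => [->//|fij]; apply/eqP; apply: contraT => gij.
case: fij; have -> : j = f ((perm finj)^-1%g j) by rewrite -[RHS](permE finj) permKV.
congr f; apply: (col_uniq _ _ j) => //.
have := fP ((perm finj)^-1%g j); rewrite -[f _](permE finj) permKV //.
Qed.

Lemma mon_conj_mem A q (d : 'I_11 -> C) a : diag_grp A -> Sym_invariant A ->
  (forall i, d i != 0) -> A a -> A (invmx (mon d q) *m a *m mon d q).
Proof.
move=> dA sA d0 Aa; rewrite -[X in _ *m X]invmxK [invmx (mon d q)]invmx_mon //.
by apply: (diag_grp_conj_mon dA sA) => // i; rewrite invr_neq0.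
Qed.

Lemma mon_conj_entry (x : 'M[C]_11) q (d : 'I_11 -> C) i : (forall i, d i != 0) ->
  (invmx (mon d q) *m x *m mon d q) (q i) (q i) = x i i.
Proof.
move=> d0; set y := invmx _ *m x *m _.
have E : mon d q *m y = x *m mon d q.
  by rewrite /y !mulmxA (mulmxV (mon_unit q d0)) mul1mx.
have /matrixP/(_ i (q i)) := E.
rewrite mxE (bigD1 (q i)) //= big1 => [|s sq]; last first.
  by rewrite monE eq_sym (negPf sq) mul0r.
rewrite [X in _ = X -> _]mxE (bigD1 i) //= big1 => [|s si]; last first.
  by rewrite monE (inj_eq perm_inj) (negPf si) mulr0.
by rewrite !monE !eqxx !addr0 mulrC => /mulIf; apply.
Qed.

Lemma det_conj (g x : 'M[C]_11) : g \in unitmx -> \det (invmx g *m x *m g) = \det x.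
Proof.
rewrite unitmxE => ug; rewrite !det_mulmx det_inv mulrAC mulVr //.
by rewrite mul1r.
Qed.

Lemma conj_set_inv (g : 'M[C]_11) H : g \in unitmx ->
  conj_set (invmx g) (conj_set g H) = H.
Proof.
move=> ug; rewrite /conj_set invmxK eqEsubset.
split=> [_ [_ [h Hh <-] <-]|h Hh].
  by rewrite !mulmxA (mulmxV ug) mul1mx (mulmxK ug).
exists (invmx g *m h *m g); first by exists h.
by rewrite !mulmxA (mulmxV ug) mul1mx (mulmxK ug).
Qed.

Lemma OmegaX2_inj n n' : @OmegaX2 R n = OmegaX2 n' -> n = n'.
Proof.
suff lt_neq k k' : (k < k')%N -> @OmegaX2 R k <> OmegaX2 k'.
  move=> E; case: (ltngtP n n') => // lt; first by case: (lt_neq _ _ lt).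
  by case: (lt_neq _ _ lt).
case: k' => // k' lek E.
have : OmegaX2 k (mon (pair_entries (o 0) (o 1) (eps R k'.+1)) 1).
  by rewrite E; apply/OmegaX2_pair/eps_exp2.
case/OmegaX2_mon => /(_ (o 0)); rewrite /pair_entries eqxx => ek _.
have e2 : (2 ^ k' = 2 ^ k * 2 ^ (k' - k))%N by rewrite -expnD subnKC.
have := eps_exp R k'; rewrite e2 exprM ek expr1n => /eqP.
by rewrite eq_sym (negPf (neq1N1 R)).
Qed.

(** Within one family A determines [z]: it is 1, or it is [eps (n + 1)] with n read off from the
    2-part of A. *)
Lemma Qstar_diag_eq H K A zA zB bA bB :
  Qstar_data H A zA bA -> Qstar_data K A zB bB -> GLconj H K -> bA = bB -> H = K.
Proof.
move=> [_ -> _ _ tA] [_ -> _ _ tB] _ E; subst bB; congr word_grp.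
case: bA tA tB => [[n [-> An]] [n' [-> An']]|[-> _] [-> _]] //.
by rewrite (@OmegaX2_inj n n') // -An -An'.
Qed.

Lemma Qstar_split_nonsplit H K A zA zB q d :
  Qstar_data H A zA false -> Qstar_data K A zB true -> (forall i, d i != 0) ->
  K = conj_set (mon d q) H -> False.
Proof.
move=> HA KA d0 KE.
have [[dA fA sA] HE zA0 HAz _] := HA; have [_ KAE zB0 KAz _] := KA.
have [m mA] := Sym_invariant_sandwiched dA fA sA.
have [zAm _] := HAz _ mA; have [zBm _] := KAz _ mA.
have [x] := word_grp_diag_entry_neq dA zB0 zBm erefl.
rewrite -KAE KE => -[h Hh <-] [x0 /eqP]; apply.
have xE := mon_conj_entry h q ((q^-1)%g (o 0)) d0.
rewrite permKV in xE; rewrite xE in x0 *; rewrite (det_conj _ (mon_unit q d0)).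
by apply: (word_grp_diag_entry dA mA zA0 zAm (sign_sqr R false)) => //; rewrite -HE.
Qed.

Lemma Qstar_conj_eq H K : Qstar H -> Qstar K -> GLconj H K -> H = K.
Proof.
move=> /Qstar_dataP [A [zA [bA HA]]] /Qstar_dataP [B [zB [bB KB]]] HK.
have [g ug KE] := HK.
have HE : H = conj_set (invmx g) K by rewrite KE conj_set_inv.
have AB := conj_diag_part HA KB ug KE.
have BA x : B x -> A (g *m x *m invmx g).
  by move=> Bx; have := conj_diag_part KB HA _ HE Bx; rewrite unitmx_inv ug invmxK; apply.
have [[dA fA sA] _ _ HAz HAt] := HA; have [[dB fB sB] _ _ _ _] := KB.
have [m mA] := Sym_invariant_sandwiched dA fA sA.
have gK x : invmx g *m (g *m x *m invmx g) *m g = x.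
  by rewrite !mulmxA (mulVmx ug) mul1mx (mulmxKV ug).
(* For scalar A, [g] need not be monomial, but conjugation fixes A pointwise, and both groups belong
   to the second family because the first excludes scalar A. *)
have [sc|nsc] := pselect (forall a, A a -> is_scalar_mx a).
  have scC a : A a -> invmx g *m a *m g = a.
    by move=> /sc /is_scalar_mxP [c ->]; rewrite -mulmxA -scalar_mxC mulmxA (mulVmx ug) mul1mx.
  have ABE : A = B.
    rewrite eqEsubset; split=> x; first by move=> Ax; rewrite -(scC _ Ax); apply: AB.
    by move=> Bx; rewrite -(gK x) scC; apply: BA.
  subst B; apply: (Qstar_diag_eq HA KB HK).
  have [_ _ _ _ KBt] := KB.
  case: bA HA HAz HAt => [|] _ _ => [_|[_]//].
  by case: bB KB KBt => // _ [_].
have [x x1 xm] := not_scalar_nontrivial_root dA mA nsc.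
have [q [d [d0 gE]]] : exists q (d : 'I_11 -> C), (forall i, d i != 0) /\ g = mon d q.
  apply: (separated_monomial mA x1 xm ug) => a /AB Ba.
  by exists (fun i => (invmx g *m a *m g) i i); exact: (diag_grp_mon dB Ba).
have ABE : A = B.
  rewrite eqEsubset; split=> y.
    move=> Ay; rewrite -(gK y); apply: AB; rewrite gE.
    exact: (diag_grp_conj_mon dA sA q d0 Ay).
  by move=> /BA Ay; rewrite -(gK y) gE; apply: (mon_conj_mem q dA sA d0); rewrite -gE.
subst B; apply: (Qstar_diag_eq HA KB HK).
case: bA bB HA KB {HAt HAz} => [] [] HA KB //; exfalso; last first.
  by apply: (Qstar_split_nonsplit HA KB d0 (q := q)); rewrite -gE.
have d0' i : (d (q^-1%g i))^-1 != 0 by rewrite invr_neq0.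
apply: (Qstar_split_nonsplit KB HA d0' (q := (q^-1)%g)).
by rewrite HE gE invmx_mon.
Qed.

End NonConjugacy.

(** * Normal forms up to conjugacy *)

Lemma expr_gcd_eq1 (F : pzRingType) (x : F) a b : (0 < a)%N ->
  x ^+ a = 1 -> x ^+ b = 1 -> x ^+ gcdn a b = 1.
Proof.
move=> a0 xa xb; case: (egcdnP b a0) => ka kb E _.
have := congr1 (GRing.exp x) E.
by rewrite exprD !(mulnC _ a) !(mulnC _ b) !exprM xa xb !expr1n mul1r.
Qed.

Lemma weight_expn (F : fieldType) (y x : nat -> F) v i m :
  weight y x v i ^+ m = weight (fun k => y k ^+ m) (fun k => x k ^+ m) v i.
Proof.
elim: v i => [|b v IH] i /=; first by rewrite expr1n.
by rewrite exprMn IH; case: b.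
Qed.

Lemma weight_const (F : fieldType) (c : F) (x : nat -> F) v i :
  weight (fun=> c) x v i = c ^+ count negb v * weight (fun=> 1) x v i.
Proof.
elim: v i => [|b v IH] i /=; first by rewrite mulr1.
by rewrite IH; case: b => /=; rewrite ?add0n ?add1n ?exprS; ring.
Qed.

(** The nine equations are rows 0 to 8 of the relation, with [u 8 = 1] dropped. Here [a, b, d, f]
    are [u 0, u 1, u 3, u 4], a prime marks the row exchanged by [w2], and [g, h] are [u 9, u 10].
    After eliminating [g] and [h], every entry is expressed through [b] and [T]. *)
Lemma relator_algebra (F : fieldType) (a b a' d f f' d' b' g h T : F) :
  a * a' = 1 -> b * b' = 1 -> d * d' = 1 -> f * f' = 1 ->
  a * d * b' * a' * f' = T -> b * g * h * f = T -> a' * b * g * d = T ->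
  d * b' * a' * b * b = T -> f * d' * f * d' = T -> f' * f' * f' * f' * g = T ->
  d' * f * d' * f * h = T -> b' * a' * b * a' = T -> g * h * a * b' = T ->
  [/\ T ^+ 11 = 1, b * b * T ^+ 3 = 1, g = 1 & h = 1] /\
  [/\ a = b * T, a' = b * T ^+ 2, f = b * T ^+ 4 & f' = b * T ^+ 10] /\
  [/\ d = T ^+ 2, d' = T ^+ 9 & b' = b * T ^+ 3].
Proof.
move=> aa bb dd ff r0 r1 r2 r3 r4 r5 r6 r7 r8.
have f0 : f != 0 by apply: contra_eq_neq ff => ->; rewrite mul0r eq_sym oner_neq0.
have d'0 : d' != 0 by apply: contra_eq_neq dd => ->; rewrite mulr0 eq_sym oner_neq0.
have T0 : T != 0 by rewrite -r4 !mulf_neq0.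
have h1 : h = 1.
  by apply: (mulfI T0); rewrite -{1}r4 -r6; ring.
have g1 : g = 1.
  have E : T * g = T.
    rewrite -{1}r3; have -> : d * b' * a' * b * b * g = (b * b') * (a' * b * g * d) by ring.
    by rewrite bb r2 mul1r.
  by apply: (mulfI T0); rewrite E mulr1.
subst g h; rewrite !mulr1 in r1 r2 r5 r6; rewrite !mul1r in r8.
have aE : a = b * T.
  by rewrite -r8 mulrCA bb mulr1.
have dE : d = T ^+ 2.
  have -> : d = d * (b * b') * (f * f') * (a * a') by rewrite aa bb ff !mulr1.
  have -> : d * (b * b') * (f * f') * (a * a') = (a * d * b' * a' * f') * (b * f) by ring.
  by rewrite r0 r1 expr2.
have bT : b * b * T ^+ 3 = 1.
  have -> : b * b * T ^+ 3 = (b * T) * (b * T) * T by ring.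
  rewrite -aE -{1}r7.
  have -> : a * a * (b' * a' * b * a') = (a * a') * (a * a') * (b * b') by ring.
  by rewrite aa bb !mulr1.
have b'E : b' = b * T ^+ 3.
  rewrite -[LHS]mul1r -bT.
  have -> : b * b * T ^+ 3 * b' = b * T ^+ 3 * (b * b') by ring.
  by rewrite bb mulr1.
have fE : f = b * T ^+ 4.
  have -> : f = (b * f) * b' by rewrite mulrAC bb mul1r.
  by rewrite r1 b'E; ring.
have T11 : T ^+ 11 = 1.
  have : f ^+ 4 * T = 1.
    rewrite -[T]r5; have -> : f ^+ 4 * (f' * f' * f' * f') = (f * f') ^+ 4 by ring.
    by rewrite ff expr1n.
  rewrite fE; have -> : (b * T ^+ 4) ^+ 4 * T = (b * b * T ^+ 3) ^+ 2 * T ^+ 11 by ring.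
  by rewrite bT expr1n mul1r.
split; [by []|split; split=> //].
- rewrite -[LHS]mul1r -bT.
  have -> : b * b * T ^+ 3 * a' = b * T ^+ 2 * (b * T * a') by ring.
  by rewrite -aE aa mulr1.
- rewrite -[LHS]mulr1 -T11.
  have -> : f' * T ^+ 11 = (b * b * T ^+ 3) * f' * T ^+ 11 by rewrite bT mul1r.
  have -> : b * b * T ^+ 3 * f' * T ^+ 11 = b * T ^+ 10 * (b * T ^+ 4 * f') by ring.
  by rewrite -fE ff mulr1.
- rewrite -[LHS]mulr1 -T11.
  have -> : d' * T ^+ 11 = T ^+ 9 * (T ^+ 2 * d') by ring.
  by rewrite -dE dd mulr1.
Qed.

(* The relators [w2 w2] and [M11_relator], read at all rows, determine the
   entries [u i] of [w2], normalised by [u 8 = 1], up to an eleventh root of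
   unity (a diagonal matrix normalising <s>) and a sign. *)
Lemma relator_solution (F : fieldType) (u : nat -> F) (T : F) :
  u 8%N = 1 -> u 0%N * u 2%N = 1 -> u 1%N * u 7%N = 1 -> u 3%N * u 6%N = 1 ->
  u 4%N * u 5%N = 1 ->
  (forall i, (i < 11)%N -> weight (fun=> 1) u M11_relator i = T) ->
  exists2 e, T ^+ 11 = 1 /\ e * e = 1 &
    forall i, (i < 11)%N ->
      u i * T ^+ (3 * w2_nat i) = (if w2_sign i then e else 1) * T ^+ (3 * i).
Proof.
move=> u8 u02 u17 u36 u45 rel.
have r0 : u 0%N * u 3%N * u 7%N * u 2%N * u 5%N = T.
  by rewrite -(rel 0%N isT) /= !mul1r mulr1 !mulrA.
have r1 : u 1%N * u 9%N * u 10%N * u 4%N = T.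
  by rewrite -[u 1%N]mulr1 -u8 -(rel 1%N isT) /= !mul1r mulr1 !mulrA.
have r2 : u 2%N * u 1%N * u 9%N * u 3%N = T.
  by rewrite -[u 1%N]mulr1 -u8 -(rel 2%N isT) /= !mul1r mulr1 !mulrA.
have r3 : u 3%N * u 7%N * u 2%N * u 1%N * u 1%N = T.
  by rewrite -(rel 3%N isT) /= !mul1r mulr1 !mulrA.
have r4 : u 4%N * u 6%N * u 4%N * u 6%N = T.
  by rewrite -[LHS]mulr1 -u8 -(rel 4%N isT) /= !mul1r mulr1 !mulrA.
have r5 : u 5%N * u 5%N * u 5%N * u 5%N * u 9%N = T.
  by rewrite -(rel 5%N isT) /= !mul1r mulr1 !mulrA.
have r6 : u 6%N * u 4%N * u 6%N * u 4%N * u 10%N = T.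
  by rewrite -(rel 6%N isT) /= !mul1r mulr1 !mulrA.
have r7 : u 7%N * u 2%N * u 1%N * u 2%N = T.
  by rewrite -[u 1%N]mulr1 -u8 -(rel 7%N isT) /= !mul1r mulr1 !mulrA.
have r8 : u 9%N * u 10%N * u 0%N * u 7%N = T.
  by rewrite -[u 9%N]mul1r -u8 -(rel 8%N isT) /= !mul1r mulr1 !mulrA.
have [[T11 bT u9 u10] [[u0 u2 u4 u5] [u3 u6 u7]]] :=
  relator_algebra u02 u17 u36 u45 r0 r1 r2 r3 r4 r5 r6 r7 r8.
have red k : T ^+ (11 + k) = T ^+ k by rewrite exprD T11 mul1r.
(* Row 1 dictates the sign: [u 1 * T ^+ 21 = e * T ^+ 3] gives [e = u 1 * T ^+ 18], and
   [T ^+ 11 = 1]. Its square is 1 because [b * b * T ^+ 3 = 1] with [b = u 1]. *)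
exists (u 1%N * T ^+ 7).
  split=> //.
  have -> : u 1%N * T ^+ 7 * (u 1%N * T ^+ 7) = u 1%N * u 1%N * T ^+ 3 * T ^+ 11 by ring.
  by rewrite bT T11 mulr1.
have E1 x y : x = u 1%N * T ^+ y -> forall k l, T ^+ (y + k) = T ^+ (7 + l) ->
    x * T ^+ k = u 1%N * T ^+ 7 * T ^+ l.
  by move=> -> k l kl; rewrite -mulrA -[RHS]mulrA -!exprD kl.
move=> [|[|[|[|[|[|[|[|[|[|[|i]]]]]]]]]]] // _; rewrite /w2_nat /w2_sign /= ?mul1r.
- exact: (E1 _ 1%N).
- by apply: (E1 _ 0%N); rewrite ?mulr1 // add0n (red 10%N).
- by apply: (E1 _ 2%N) => //; rewrite (red 2%N).
- by rewrite u3 -exprD (red 9%N).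
- exact: (E1 _ 4%N).
- exact: (E1 _ 10%N).
- by rewrite u6 -exprD.
- by apply: (E1 _ 3%N) => //; rewrite (red 17%N) (red 6%N).
- by rewrite u8 mul1r.
- by rewrite u9 mul1r.
- by rewrite u10 mul1r.
Qed.

Section NormalForm.

Variable R : realType.
Notation C := R[i].
Implicit Types (A G H K : set 'M[C]_11).

Definition M11_good G : Prop :=
  [/\ is_grp G, finite_set G, G `<=` @monomial R, irreducible_grp G &
      perm_part G = M11].

Lemma conj_mon_good G q (d : 'I_11 -> C) : (forall i, d i != 0) ->
  [/\ is_grp G, finite_set G, G `<=` @monomial R & irreducible_grp G] ->
  [/\ is_grp (conj_set (mon d q) G), finite_set (conj_set (mon d q) G),
      conj_set (mon d q) G `<=` @monomial R & irreducible_grp (conj_set (mon d q) G)].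
Proof.
move=> d0 [[G1 uG mulG invG] fG mG iG].
have : conj_set (mon d q) G `<=` @monomial R.
  move=> _ [x Gx <-]; have [p [c [c0 ->]]] := monomialP mG Gx.
  rewrite (invmx_mon q d0) !mon_mul.
  eexists; eexists (\row_i _); split; last first.
    by rewrite diag_perm_mon; apply: eq_mon => i; rewrite mxE.
  by move=> i; rewrite mxE !mulf_neq0 ?invr_neq0.
move: (mon d q) (mon_unit q d0) => g ug mK.
split.
- split.
  + by exists 1%:M => //; rewrite mulmx1 (mulVmx ug).
  + by move=> _ [x Gx <-]; rewrite !unitmx_mul unitmx_inv ug (uG _ Gx).
  + move=> _ _ [x Gx <-] [y Gy <-]; exists (x *m y); first exact: (mulG _ _ Gx Gy).
    by rewrite (conj_mx_mul _ _ ug).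
  + move=> _ [x Gx <-]; exists (invmx x); first exact: invG.
    by rewrite (conj_mx_inv ug (uG _ Gx)).
- exact: finite_image.
- by [].
- move=> U invU; have [|V0|Vf] := iG (U *m invmx g).
  + move=> h Gh; have : (U *m (invmx g *m h *m g) <= U)%MS by apply: invU; exists h.
    by move/(submxMr (invmx g)); rewrite !mulmxA (mulmxK ug).
  + by left; rewrite -(mulmxKV ug U) V0 mul0mx.
  + by right; move: Vf; rewrite /row_full mxrankMfree // row_free_unit unitmx_inv.
Qed.

Lemma conj_mon_perm_part G q (d : 'I_11 -> C) : (forall i, d i != 0) ->
  G `<=` @monomial R -> perm_part (conj_set (mon d q) G) = (perm_part G :^ q)%g.
Proof.
move=> d0 mG; apply/setP => p; apply/idP/imsetP => [/perm_partP [c [c0 [x Gx]]]|].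
  have [r [e [e0 xE]]] := monomialP mG Gx; rewrite xE in Gx *.
  rewrite (invmx_mon q d0) !mon_mul => E; exists r; first exact: mem_perm_part Gx.
  have [|<- _] := mon_inj _ E; last by rewrite conjgE mulgA.
  by move=> i; rewrite !mulf_neq0 ?invr_neq0.
move=> [r /perm_partP [e [e0 Ge]] ->].
have -> : (r ^ q = q^-1 * r * q)%g by rewrite conjgE mulgA.
apply: (@mem_perm_part _ _
  (fun i => (d ((q^-1)%g i))^-1 * e ((q^-1)%g i) * d ((q^-1 * r)%g i))).
  by move=> i; rewrite !mulf_neq0 ?invr_neq0.
by exists (mon e r) => //; rewrite (invmx_mon q d0) !mon_mul.
Qed.

Lemma GLconj_trans G H K : GLconj G H -> GLconj H K -> GLconj G K.
Proof.
move=> [g ug ->] [h uh ->]; exists (g *m h); first by rewrite unitmx_mul ug.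
have inv_gh : invmx (g *m h) = invmx h *m invmx g.
  have ugh : g *m h \in unitmx by rewrite unitmx_mul ug.
  apply: (can_inj (mulKmx ugh)); rewrite (mulmxV ugh) !mulmxA -[g *m h *m _]mulmxA.
  by rewrite (mulmxV uh) mulmx1 (mulmxV ug).
rewrite /conj_set inv_gh eqEsubset; split=> [_ [_ [x Gx <-] <-]|_ [x Gx <-]].
  by exists x => //; rewrite !mulmxA.
by exists (invmx g *m x *m g); [exists x | rewrite !mulmxA].
Qed.

Lemma good_grp_M11_good G : good_grp G -> exists2 K, M11_good K & GLconj G K.
Proof.
move=> [gG fG mG iG pG].
have gP : group_set (perm_part G).
  have [G1 _ mulG _] := gG; apply/group_setP; split.
    apply: (@mem_perm_part _ _ (fun=> 1)); first by move=> i; exact: oner_neq0.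
    by rewrite mon1.
  move=> p q /perm_partP [d [d0 Gd]] /perm_partP [e [e0 Ge]].
  apply: (@mem_perm_part _ _ (fun i => d i * e (p i))).
    by move=> i; rewrite mulf_neq0.
  by rewrite -mon_mul; apply: mulG.
have [x xE] := @isog_M11_conj (Group gP) pG.
have o0 (i : 'I_11) : (fun=> 1 : C) i != 0 by exact: oner_neq0.
have [gK fK mK iK] := conj_mon_good x o0 (And4 gG fG mG iG).
exists (conj_set (mon (fun=> 1) x) G).
  by split=> //; rewrite conj_mon_perm_part.
by exists (mon (fun=> 1) x) => //; exact: mon_unit.
Qed.

Lemma conj_diag_M11_good G (b : 'I_11 -> C) : (forall i, b i != 0) ->
  M11_good G -> M11_good (conj_set (mon b 1) G).
Proof.
move=> b0 [gG fG mG iG pG].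
have [gK fK mK iK] := conj_mon_good 1%g b0 (And4 gG fG mG iG).
by split=> //; rewrite conj_mon_perm_part // conjsg1.
Qed.

(** The diagonal [b] solves [b (k + 1) = b k * c / y k] by partial products; the cycle closes,
    [b 11 = b 0 = 1], exactly because [c] is an 11-th root of the product of the [y k]. *)
Lemma M11_good_s G : M11_good G ->
  exists K, [/\ M11_good K, GLconj G K & exists2 c, c != 0 & K (mon (fun=> c) s_perm)].
Proof.
move=> GG; have [gG fG mG iG pG] := GG.
have : s_perm \in perm_part G by rewrite pG; apply: mem_gen; rewrite !inE eqxx.
case/perm_partP => y [y0 Gy].
pose c : C := 11.-root (\prod_i y i).
have c11 : c ^+ 11 = \prod_i y i by rewrite rootCK.
have P0 : \prod_i y i != 0 by apply/prodf_neq0.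
have c0 : c != 0.
  by apply: contraNneq P0 => c0; rewrite -c11 c0 expr0n.
pose b k : C := \prod_(0 <= j < k) (c / y (o j)).
have b0 k : b k != 0.
  by rewrite prodf_seq_neq0; apply/allP => j _; rewrite mulf_neq0 ?invr_neq0.
have b11 : b 11%N = 1.
  rewrite /b big_split /= prodr_const_nat subn0 prodfV c11 big_mkord.
  have -> : \prod_(i < 11) y (o i) = \prod_i y i.
    by apply: eq_bigr => i _; rewrite o_val.
  exact: divff.
have b0' (i : 'I_11) : b i != 0 by [].
exists (conj_set (mon (fun i : 'I_11 => b i) 1) G); split.
- exact: conj_diag_M11_good.
- by exists (mon (fun i : 'I_11 => b i) 1) => //; exact: mon_unit.
exists c => //; exists (mon y s_perm) => //.
rewrite (mon_conj_diag y s_perm b0'); apply: eq_mon => i.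
have -> : b (s_perm i) = b i * (c / y i).
  have bS : b i.+1 = b i * (c / y i) by rewrite /b big_nat_recr //= o_val.
  rewrite s_permE /s_nat; case: eqP => [i10|//]; rewrite -bS i10 b11.
  by rewrite /b big_geq.
have yi := y0 i; have bi := b0 i.
by field; rewrite yi bi.
Qed.

Definition diag_part G : set 'M[C]_11 := [set x | G x /\ is_diag_mx x].

Lemma diag_part_grp G : M11_good G ->
  [/\ diag_grp (diag_part G), finite_set (diag_part G) & Sym_invariant (diag_part G)].
Proof.
move=> [gG fG mG _ pG]; have [G1 uG mulG invG] := gG.
have dD : diag_grp (diag_part G).
  have monD x : diag_part G x -> exists2 d : 'I_11 -> C, (forall i, d i != 0) & x = mon d 1.
    move=> [Gx dx]; exists (fun i => x i i); last exact: diag_mon.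
    by move=> i; apply: unit_diag_neq0 => //; exact: uG.
  split=> [|x []//]; split.
  - by split=> //; rewrite -mon1 is_diag_mon.
  - by move=> x [/uG].
  - move=> x y Dx Dy; split; first by apply: mulG; [case: Dx|case: Dy].
    have [d _ ->] := monD _ Dx; have [e _ ->] := monD _ Dy.
    by rewrite mon_mul mulg1 is_diag_mon.
  - move=> x Dx; split; first by apply: invG; case: Dx.
    by have [d d0 ->] := monD _ Dx; rewrite (invmx_mon _ d0) invg1 is_diag_mon.
have fD : finite_set (diag_part G) by apply: sub_finite_set fG => x [].
split=> //; apply: (M11_invariant_Sym dD) => t d tM [Gd _].
split; last exact: is_diag_mon.
move: tM; rewrite -pG => /perm_partP [f [f0 Gf]].
have -> : mon (fun i => d (t i)) 1 = mon f t *m mon d 1 *m invmx (mon f t).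
  rewrite (invmx_mon t f0) !mon_mul mulg1 mulgV; apply: eq_mon => i.
  by rewrite permK mulrAC divff ?mul1r.
by apply: (mulG); [apply: (mulG) | apply: invG].
Qed.

End NormalForm.

(** * Normalising the entries of lifts of the generators *)

Section Existence.

Variable R : realType.
Notation C := R[i].
Implicit Types (A G H K : set 'M[C]_11).

Lemma word_mx_mem G (y x : nat -> C) v : is_grp G ->
  G (letter_mx y x false) -> G (letter_mx y x true) -> G (word_mx y x v).
Proof.
move=> [G1 _ mulG _] Gs Gw; elim: v => [//|b v IH] /=.
by apply: mulG IH; case: b.
Qed.

(** A relation lifts to a diagonal element of G, whose entries share their m-th power by the upper
    bound of the sandwich. Point 8, fixed by [w2], is the reference row. *)
Lemma relator_weight G m (y x : nat -> C) v i : is_grp G ->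
  sandwiched (diag_part G) m ->
  G (letter_mx y x false) -> G (letter_mx y x true) -> wperm v = 1%g ->
  (i < 11)%N -> weight y x v i ^+ m = weight y x v 8%N ^+ m.
Proof.
move=> gG [_ _ Dm] Gs Gw v1 lti.
have := word_mx_mem v gG Gs Gw; rewrite word_mxE v1 => Gv.
have := Dm _ (conj Gv (is_diag_mon _)) (o i) (o 8).
by rewrite !val_o.
Qed.

Lemma w2_entries_exp G m (c : C) (x : nat -> C) : M11_good G ->
  sandwiched (diag_part G) m -> c != 0 -> (forall k, (k < 11)%N -> x k != 0) ->
  G (letter_mx (fun=> c) x false) -> G (letter_mx (fun=> c) x true) ->
  exists q T e : C, [/\ q != 0, T ^+ 11 = 1, e * e = 1 &
    forall i, (i < 11)%N ->
      x i ^+ m * T ^+ (3 * w2_nat i) =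
      q * (if w2_sign i then e else 1) * T ^+ (3 * i)].
Proof.
move=> [gG _ _ _ _] mD c0 x0 Gs Gw.
pose q := x 8%N ^+ m; have q0 : q != 0 by rewrite expf_neq0 ?x0.
have x_8 k : (k < 11)%N -> x k ^+ m != 0 by move=> ltk; rewrite expf_neq0 ?x0.
(* Dividing by [q] normalises [u 8 = 1]. As [w2] fixes 8, the relation [w2 w2] compared with row 8
   then reads [u i * u (w2 i) = 1]. *)
pose u k := x k ^+ m / q.
have rel v i : wperm v = 1%g -> (i < 11)%N ->
    weight (fun=> 1) u v i = weight (fun=> 1) u v 8%N.
  move=> v1 lti.
  have := relator_weight gG mD Gs Gw v1 lti.
  rewrite !weight_expn [in LHS]weight_const [in RHS]weight_const.
  move/(mulfI (expf_neq0 _ (expf_neq0 _ c0))) => E.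
  have scale k : weight (fun=> 1) (fun k => x k ^+ m) v k =
      q ^+ count id v * weight (fun=> 1) u v k.
    elim: (v) k => [|b w IH] k /=; first by rewrite mulr1.
    rewrite IH; case: b => /=; rewrite ?add0n ?add1n ?exprS ?mul1r //.
    by rewrite /u; field.
  by rewrite !scale in E; move: E => /(mulfI (expf_neq0 _ q0)).
have u8 : u 8%N = 1 by rewrite /u divff.
have ww i : (i < 11)%N -> u i * u (w2_nat i) = 1.
  move=> lti; have := rel [:: true; true] i.
  rewrite /= !mulr1 u8 mul1r => -> //.
  by rewrite mulg1 w2_perm2.
have [|e [T11 ee] uE] := relator_solution (T := weight (fun=> 1) u M11_relator 8%N)
    u8 (ww 0%N isT) (ww 1%N isT) (ww 3%N isT) (ww 4%N isT).
  by move=> i; apply: rel; exact: (@wperm_eq M11_relator [::] isT).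
exists q, (weight (fun=> 1) u M11_relator 8%N), e; split=> // i lti.
by rewrite -[RHS]mulrA -uE // mulrA [q * _]mulrC divfK.
Qed.

Lemma M11_good_entries G : M11_good G -> exists K m cy cx e,
  [/\ M11_good K, GLconj G K, sandwiched (diag_part K) m, e * e = 1 :> C &
   exists y x : nat -> C,
   [/\ K (letter_mx y x false), K (letter_mx y x true),
       cy != 0 /\ cx != 0, forall k, (k < 11)%N -> y k ^+ m = cy &
       forall k, (k < 11)%N -> x k ^+ m = cx * (if w2_sign k then e else 1)]].
Proof.
move=> /M11_good_s [H [GH cGH [c c0 Hs]]].
have [gH fH mH iH pH] := GH.
have [dD fD sD] := diag_part_grp GH.
have [m mD] := Sym_invariant_sandwiched dD fD sD; have [m0 _ _] := mD.
have : w2_perm \in perm_part H by rewrite pH; apply: mem_gen; rewrite !inE eqxx orbT.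
case/perm_partP => x' [x'0 Hw].
pose x k := x' (o k).
have Hs1 : H (letter_mx (fun=> c) x false) by [].
have Hw1 : H (letter_mx (fun=> c) x true).
  by apply: (sub_eq_mon Hw) => i; rewrite /x o_val.
have x0 k : (k < 11)%N -> x k != 0 by move=> _; exact: x'0.
have [q [T [e [q0 T11 ee xE]]]] := w2_entries_exp GH mD c0 x0 Hs1 Hw1.
pose t : C := m.-root T.
have tm : t ^+ m = T by rewrite rootCK.
have T0 : T != 0 by apply: contra_eq_neq T11 => ->; rewrite expr0n /= eq_sym oner_neq0.
have t0 : t != 0.
  by apply: contraNneq T0 => t0; rewrite -tm t0 expr0n gtn_eqF.
(* On m-th powers, conjugation by [b] cancels the factors [T ^+ (3 * i)] in the entries of [w2]. It
   multiplies those of [s] by the constant [T ^+ 3], also at the wrap from 10 to 0, since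
   [T ^+ 33 = 1]. *)
pose b k : C := t ^+ (3 * k); have b0 (i : 'I_11) : b i != 0 by rewrite expf_neq0.
have bm k : b k ^+ m = T ^+ (3 * k) by rewrite /b exprAC tm.
exists (conj_set (mon (fun i : 'I_11 => b i) 1) H), m, (c ^+ m * T ^+ 3), q, e.
have HK : GLconj H (conj_set (mon (fun i : 'I_11 => b i) 1) H).
  by exists (mon (fun i : 'I_11 => b i) 1) => //; exact: mon_unit.
have conjb (d : 'I_11 -> C) : invmx (mon (fun i : 'I_11 => b i) 1) *m mon d 1 *m
    mon (fun i : 'I_11 => b i) 1 = mon d 1.
  rewrite (mon_conj_diag d 1 b0); apply: eq_mon => i.
  by rewrite perm1 mulrAC mulVf ?mul1r.
have DE : diag_part (conj_set (mon (fun i : 'I_11 => b i) 1) H) = diag_part H.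
  have ub := mon_unit 1%g b0.
  rewrite eqEsubset; split=> [z [[h Hh hz] dz]|z [Hz dz]]; split=> //.
    have zE := diag_mon dz.
    have := etrans hz (etrans zE (esym (conjb _))).
    by move=> /(can_inj (mulmxK ub)) /(can_inj (mulKVmx ub)) hE; rewrite zE -hE.
  by exists z => //; rewrite (diag_mon dz) conjb.
split=> //.
- exact: conj_diag_M11_good.
- exact: GLconj_trans cGH HK.
- by rewrite DE.
exists (fun k => (b k)^-1 * c * b (s_nat k)), (fun k => (b k)^-1 * x k * b (w2_nat k)).
split.
- exists (mon (fun=> c) s_perm) => //; rewrite (mon_conj_diag _ s_perm b0).
  by apply: eq_mon => i; rewrite s_permE.
- exists (mon x' w2_perm) => //; rewrite (mon_conj_diag _ w2_perm b0).
  by apply: eq_mon => i; rewrite w2_permE /x o_val.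
- by split=> //; rewrite mulf_neq0 ?expf_neq0.
- move=> k ltk; rewrite !exprMn exprVn !bm /s_nat.
  apply: (mulfI (expf_neq0 (3 * k) T0)).
  rewrite !mulrA divff ?expf_neq0 // mul1r.
  case: eqP => [->|_]; last by rewrite mulnS exprD; ring.
  rewrite muln0 expr0 mulr1.
  have -> : T ^+ (3 * 10) * c ^+ m * T * T * T = c ^+ m * T ^+ (11 * 3) by ring.
  by rewrite exprM T11 expr1n mulr1.
- move=> k ltk; rewrite !exprMn exprVn !bm.
  apply: (mulfI (expf_neq0 (3 * k) T0)).
  by rewrite !mulrA divff ?expf_neq0 // mul1r xE // mulrC mulrA.
Qed.

End Existence.

(** * From the lifts to the exact generators *)

Lemma sign_quotient (F : fieldType) (p r e : F) (a b : bool) :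
  e * e = 1 -> p != 0 -> r != 0 ->
  p * r * (if a (+) b then e else 1) /
    ((if a then e else 1) * (p * r * (if b then e else 1))) = 1.
Proof.
move=> ee p0 r0; have pr0 : p * r != 0 by rewrite mulf_neq0.
have e0 : e != 0 by apply: contra_eq_neq ee => ->; rewrite mul0r eq_sym oner_neq0.
case: a; case: b => /=; rewrite ?mulr1 ?mul1r.
- by rewrite mulrCA ee mulr1 divff.
- by rewrite [e * _]mulrC divff // mulf_neq0.
- by rewrite divff // mulf_neq0.
- exact: divff.
Qed.

Section Classify.

Variable R : realType.
Notation C := R[i].
Implicit Types (A G H K : set 'M[C]_11).

(* Both letters are commutators of words; in the given lifts the same
   commutators agree with the letters up to elements of the diagonal part. *)
Lemma letter_mx_mem G m (cy cx e z : C) (y x : nat -> C) b :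
  M11_good G -> sandwiched (diag_part G) m -> e * e = 1 -> z != 0 -> z ^+ m = e ->
  G (letter_mx y x false) -> G (letter_mx y x true) -> cy != 0 -> cx != 0 ->
  (forall k, (k < 11)%N -> y k ^+ m = cy) ->
  (forall k, (k < 11)%N -> x k ^+ m = cx * (if w2_sign k then e else 1)) ->
  G (letter_mx (ones R) (w2_coef z) b).
Proof.
move=> [gG _ _ _ _] mD ee z0 zm Gs Gw cy0 cx0 ym xm.
have [G1 uG mulG invG] := gG; have [m0 D_in _] := mD.
have m_neq0 a c : c != 0 -> a ^+ m = c -> a != 0 :> C.
  by move=> c0 ac; apply: contraNneq c0 => a0; rewrite -ac a0 expr0n gtn_eqF.
have e0 : e != 0.
  by apply: contra_eq_neq ee => ->; rewrite mul0r eq_sym oner_neq0.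
have y0 k : (k < 11)%N -> y k != 0 by move=> /ym; apply: m_neq0.
have x0 k : (k < 11)%N -> x k != 0.
  by move=> /xm; apply: m_neq0; rewrite mulf_neq0 //; case: ifP; rewrite ?oner_neq0.
have cert := comm_wordsP b; case: (comm_words b) cert => u v /allP cert.
pose U := weight y x (u ++ v); pose V := weight y x (v ++ u).
pose L k := if b then w2_coef z k else ones R k.
pose pb := if b then w2_perm else s_perm.
have V0 (i : 'I_11) : V i != 0 by apply: weight_neq0.
have U0 (i : 'I_11) : U i != 0 by apply: weight_neq0.
have L0 (i : 'I_11) : L i != 0.
  by rewrite /L; case: (b); [exact: w2_coef_neq0 | exact: oner_neq0].
(* The discrepancy between the commutator of the lifts, an element of G, and the exact letter. Both
   words have the same letter counts, so [cy] and [cx] cancel in its m-th power, and the certificate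
   balances the signs. *)
pose d (i : 'I_11) := U i / (L i * V (pb i)).
have permE : wperm (u ++ v) = (pb * wperm (v ++ u))%g.
  apply: esym; apply: (@wperm_eq (b :: v ++ u)).
  by apply/allP => i /cert /andP [].
have factor : word_mx y x (u ++ v) =
    mon d 1 *m letter_mx (ones R) (w2_coef z) b *m word_mx y x (v ++ u).
  rewrite !word_mxE permE /letter_mx !mon_mul mul1g; apply: eq_mon => i.
  rewrite !perm1 -/(L i) -/pb /d -/U -/V -mulrA divfK //.
  by rewrite mulf_neq0.
have Guv := word_mx_mem (u ++ v) gG Gs Gw.
have Gvu := word_mx_mem (v ++ u) gG Gs Gw.
have dm i : d i ^+ m = 1.
  have iI : (i : nat) \in iota 0 11 by rewrite mem_iota /= ltn_ord.
  have /andP [_ /eqP sgn] := cert i iI.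
  have Lm : L i ^+ m = if b && w2_sign i then e else 1.
    rewrite /L; case: (b); last by rewrite expr1n.
    by rewrite (w2_coef_exp zm ee) ?mul1r.
  rewrite /d expr_div_n exprMn Lm /U /V.
  rewrite (weight_exp (u ++ v) ee ym xm) // (weight_exp (v ++ u) ee ym xm) //.
  rewrite !count_cat [(count negb v + _)%N]addnC [(count id v + _)%N]addnC.
  have <- : letter_nat b i = pb i :> nat by rewrite -letter_permE.
  move: sgn => /= <-; set p := _ ^+ _; set r := cx ^+ _.
  have p0 : p != 0 by rewrite expf_neq0.
  have r0 : r != 0 by rewrite expf_neq0.
  exact: sign_quotient.
(* A commutator and the exact letter both have determinant 1, hence so has the discrepancy, which
   the lower bound of the sandwich now places in G. *)
have detd : \prod_i d i = 1.
  have detL : \det (letter_mx (ones R) (w2_coef z) b) = 1.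
    by have := det_word_mx z0 [:: b]; rewrite /= mulmx1.
  have := congr1 determinant factor.
  rewrite !word_mx_cat [LHS]det_mulmx [RHS]det_mulmx (det_mulmx (mon d 1)).
  rewrite (det_mulmx (word_mx y x v)) detL det_mon perm.odd_perm1 mul1r mulr1.
  have wu w : word_mx y x w \in unitmx by apply: uG; apply: word_mx_mem.
  have u0 w : \det (word_mx y x w) != 0 by rewrite -unitfE -unitmxE.
  rewrite [\det (word_mx y x v) * _]mulrC -[LHS]mul1r => /mulIf E.
  by apply/esym/E; rewrite mulf_neq0.
have Gd : G (mon d 1) by case: (D_in _ dm detd).
have ud := uG _ Gd; have uvu := uG _ Gvu.
have -> : letter_mx (ones R) (w2_coef z) b =
    invmx (mon d 1) *m word_mx y x (u ++ v) *m invmx (word_mx y x (v ++ u)).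
  by rewrite factor [invmx (mon d 1) *m _]mulmxA (mulmxK uvu) (mulKmx ud).
by apply: (mulG); [apply: (mulG) => //; apply: invG | apply: invG].
Qed.

Lemma M11_good_word_grp G z : M11_good G -> z != 0 ->
  (forall b, G (letter_mx (ones R) (w2_coef z) b)) -> G = word_grp (diag_part G) z.
Proof.
move=> GG z0 Gl; have [gG fG mG iG pG] := GG; have [G1 uG mulG invG] := gG.
rewrite eqEsubset; split=> [x Gx|_ [v [a [[Ga _] ->]]]]; last first.
  by apply: mulG => //; apply: word_mx_mem.
have [p [d [d0 xE]]] := monomialP mG Gx.
have [v pE] : exists v, p = wperm v.
  by apply: M11_wordP; rewrite -pG; apply: (mem_perm_part d0); rewrite -xE.
have Gv : G (word_mx (ones R) (w2_coef z) v) by apply: word_mx_mem.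
have uv := uG _ Gv.
exists v, (invmx (word_mx (ones R) (w2_coef z) v) *m x); split; last by rewrite (mulKVmx uv).
split; first by apply: (mulG) => //; apply: invG.
have w0 (i : 'I_11) : weight (ones R) (w2_coef z) v i != 0.
  by apply: weight_neq0; [move=> *; exact: oner_neq0 | exact: w2_coef_neq0 |].
by rewrite xE pE word_mxE (invmx_mon _ w0) mon_mul mulVg is_diag_mon.
Qed.

(** Write [m = q * 2 ^ n] with [q] odd: raising [eps (n + 1)] to the power [2 ^ n] gives -1, and the
    odd power [q] keeps it. *)
Lemma w2_coef_sqrt m (e : C) : (0 < m)%N -> e * e = 1 ->
  e = 1 \/ e = -1 /\ eps R (logn 2 m).+1 ^+ m = -1.
Proof.
move=> m0 /eqP; rewrite -expr2 sqrf_eq1 => /orP [] /eqP ->; [by left|right].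
split=> //; have [q odd_q {2}->] := pfactor_coprime (isT : prime 2) m0.
rewrite coprime2n in odd_q.
by rewrite mulnC exprM eps_exp -signr_odd odd_q.
Qed.

(** For an element of 2-power order in A, ratios of entries have order dividing both [m] and a power
    of 2, hence [2 ^ n]. All entries thus share one [2 ^ n]-th power; determinant 1 makes its 11-th
    power 1, and as it also has 2-power order it is 1. *)
Lemma diag_part_OmegaX2 A m : diag_grp A -> sandwiched A m ->
  A `&` @X2 R = OmegaX2 (logn 2 m).
Proof.
move=> dA [m0 A_in A_exp]; set n := logn 2 m.
have dvd_m : (2 ^ n %| m)%N by exact: pfactor_dvdnn.
rewrite eqEsubset; split=> a.
  move=> [Aa Xa]; have [_ [k ak]] := Xa; have [_ _ det1] := Xa.1.
  have aE := diag_grp_mon dA Aa; rewrite aE in Aa ak det1 *.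
  move: Aa ak det1; move: (fun i => a i i) => d Ad dk det1.
  have dk' i : d i ^+ (2 ^ k) = 1.
    have := congr1 (fun M : 'M[C]_11 => M i i) dk.
    by rewrite mon_expn /= monE perm1 eqxx mxE eqxx.
  have prod1 : \prod_i d i = 1.
    by move: det1; rewrite det_mon perm.odd_perm1 mul1r.
  have d0 := diag_grp_neq0 dA ord0 Ad.
  have same i : d i ^+ (2 ^ n) = d ord0 ^+ (2 ^ n).
    have r1 : (d i / d ord0) ^+ gcdn m (2 ^ k) = 1.
      apply: expr_gcd_eq1 => //; first
        by rewrite expr_div_n (A_exp _ Ad i ord0) divff ?expf_neq0.
      by rewrite expr_div_n !dk' divr1.
    have : (d i / d ord0) ^+ (2 ^ n) = 1.
      have : (gcdn m (2 ^ k) %| 2 ^ n)%N.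
        have /(dvdn_pfactor _ _ (isT : prime 2)) [l _ lE] := dvdn_gcdr m (2 ^ k).
        by rewrite lE dvdn_exp2l // /n -pfactor_dvdn // -lE dvdn_gcdl.
      by case/dvdnP => l ->; rewrite mulnC exprM r1 expr1n.
    rewrite expr_div_n => E.
    by rewrite -[LHS](divfK (expf_neq0 (2 ^ n) d0)) E mul1r.
  have d011 : (d ord0 ^+ (2 ^ n)) ^+ 11 = 1.
    rewrite -{1}[11%N]card_ord -prodr_const.
    by rewrite -(eq_bigr _ (fun i _ => same i)) prodrXl prod1 expr1n.
  have d0k : (d ord0 ^+ (2 ^ n)) ^+ (2 ^ k) = 1 by rewrite exprAC dk' expr1n.
  have := expr_gcd_eq1 (isT : (0 < 11)%N) d011 d0k.
  have -> : gcdn 11 (2 ^ k) = 1%N by apply/eqP; rewrite -/(coprime _ _) coprimeXr.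
  rewrite expr1 => d0n; apply/OmegaX2_mon; split=> // i.
  by rewrite same d0n.
move=> Oa; have [Xa _] := Oa; split=> //; have [_ da _] := Xa.1.
have aE := diag_mon da; rewrite aE in Oa *.
have [dn d1] := (OmegaX2_mon n _).1 Oa.
apply: A_in => // i; have /dvdnP [l ->] := dvd_m.
by rewrite mulnC exprM dn expr1n.
Qed.

(** If A were scalar, the group would consist of scalar multiples of permutation matrices, which
    preserve the line of the all-ones vector; [U] is a rank one matrix with this row space. *)
Lemma irreducible_not_scalar A : irreducible_grp (word_grp A (1 : C)) ->
  ~ (forall a, A a -> is_scalar_mx a).
Proof.
move=> irr sc; pose U : 'M[C]_11 := const_mx 1.
have perm_word v : word_mx (ones R) (w2_coef 1) v = perm_mx (wperm v).
  elim: v => [|b v IH] /=; first by rewrite perm_mx1.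
  rewrite IH perm_mxM; congr (_ *m _); case: b.
    by rewrite -w2_mxE.
  by rewrite -(s_mxE 1).
have [|U0|Uf] := irr U.
- move=> _ [v [a [/sc /is_scalar_mxP [c ->] ->]]].
  rewrite perm_word mulmxA mul_mx_scalar.
  have -> : U *m perm_mx (wperm v) = U.
    rewrite -[wperm v]invgK -col_permE; apply/matrixP => i j; by rewrite !mxE.
  exact: scalemx_sub.
- by have /matrixP/(_ 0 0) := U0; rewrite !mxE => /eqP; rewrite oner_eq0.
have UE : U = (const_mx 1 : 'cV[C]_11) *m (const_mx 1 : 'rV[C]_11).
  by apply/matrixP => i j; rewrite !mxE big_ord1 !mxE mulr1.
have := mulmx_max_rank (const_mx 1 : 'cV[C]_11) (const_mx 1 : 'rV[C]_11).
by rewrite -UE (eqP Uf).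
Qed.

Lemma good_grp_Qstar G : good_grp G -> exists2 H, Qstar H & GLconj G H.
Proof.
move=> /good_grp_M11_good [H0 GH0 c0].
have [G1 [m [cy [cx [e [GG c1 mD ee]]]]]] := M11_good_entries GH0.
move=> [y [x [Gs Gw [cy0 cx0] ym xm]]].
exists G1; last exact: GLconj_trans c0 c1.
have [dD fD sD] := diag_part_grp GG; have [m0 _ _] := mD.
have irr : irreducible_grp G1 by case: GG.
have GE z : z != 0 -> z ^+ m = e -> G1 = word_grp (diag_part G1) z.
  move=> z0 zm; apply: M11_good_word_grp => // b.
  exact: (letter_mx_mem b GG mD ee z0 zm Gs Gw cy0 cx0 ym xm).
have [e1|[e1 zm]] := w2_coef_sqrt m0 ee.
  have G1E := GE 1 (oner_neq0 _) (etrans (expr1n _ _) (esym e1)).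
  left; exists (diag_part G1); split=> //.
    by apply: irreducible_not_scalar; rewrite -G1E.
  by rewrite {1}G1E -(gen_word_grp dD sD (oner_neq0 _)) -s_mxE -w2_mxE.
have z0 := eps_neq0 R (logn 2 m).
have G1E := GE _ z0 (etrans zm (esym e1)).
right; exists (logn 2 m), (diag_part G1); split=> //.
  exact: diag_part_OmegaX2.
by rewrite {1}G1E -(gen_word_grp dD sD z0) -s_mxE -w2_mx_diag.
Qed.

End Classify.

Local Close Scope ring_scope.

Theorem theorem9p25 (R : realType) :
  (forall H : set 'M[R[i]]_11, Qstar H -> good_grp H) /\
  (forall G : set 'M[R[i]]_11, good_grp G -> exists2 H, Qstar H & GLconj G H) /\
  (forall H K : set 'M[R[i]]_11, Qstar H -> Qstar K -> H <> K -> ~ GLconj H K).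
Proof.
split; [|split].
- by move=> H /Qstar_dataP [A [z [b HA]]]; exact: (Qstar_data_good HA).
- exact: good_grp_Qstar.
- by move=> H K HQ KQ neHK HK; apply: neHK; exact: Qstar_conj_eq.
Qed.
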